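(* Let $\{f_n\}_n$, $\{g_{n,k}\}_k$, $\psi_{n,k}$, $a_{n,k}$ be as in the context, let $k$ be a fixed index, and let $\mathcal{A}_k$ be as in the context. Let $\gamma_1,\gamma_2\in C_+(\overline{B})$. If $\gamma_1-\gamma_2\in\mathcal{A}_k$, then $$\|\gamma_1-\gamma_2\|_{L^2(B)}\leq \frac{|\partial B|^{1/2}}{\inf_n|g_{n,k}(1)|}\,C_{\partial B}\,\|\Lambda(\gamma_1)-\Lambda(\gamma_2)\|_{\mathscr{L}(H^{1/2}(\partial B),H^{-1/2}(\partial B))},$$ where $|\partial B|$ is the surface measure of $\partial B$.
   Context: Let $d\ge 2$ be an integer and let $B$ be the Euclidean unit ball in $\mathbb{R}^d$. Let $C_+(\overline{B})=\{\gamma\in C(\overline{B};\mathbb{R}) : \min_{x\in\overline{B}}\gamma(x)>0\}$. For $\gamma\in C_+(\overline{B})$, the Dirichlet-to-Neumann map $\Lambda(\gamma)\colon H^{1/2}(\partial B)\to H^{-1/2}(\partial B)$ is defined by $u|_{\partial B}\mapsto \nu\cdot(\gamma\nabla u)|_{\partial B}$, where $u\in H^1(B)$ solves $-\nabla\cdot(\gamma\nabla u)=0$ in $B$ (weakly) and $\nu$ is the outward unit normal. $\mathscr{L}(X,Y)$ denotes the bounded linear operators from $X$ to $Y$ with the operator norm. The constant $C_{\partial B}$: by a known theorem of Sylvester and Uhlmann (boundary stability) there is a constant $C_{\partial B}>0$, not depending on $\gamma_1,\gamma_2$, such that for all $\gamma_1,\gamma_2\in C_+(\overline{B})$, $$\|\gamma_1-\gamma_2\|_{L^\infty(\partial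 B)}\le C_{\partial B}\|\Lambda(\gamma_1)-\Lambda(\gamma_2)\|_{\mathscr{L}(H^{1/2}(\partial B),H^{-1/2}(\partial B))}.$$ $C_{\partial B}$ denotes this constant. Standing assumptions on the basis functions (polar coordinates $x=r\theta$, $r=|x|$, $\theta=x/|x|\in\partial B$; $n$ and $k$ range over countable index sets): (i) $\{f_n\}_n$ is an orthonormal basis for $L^2(\partial B)$ (complex-valued). (ii) For each $n$, $\{g_{n,k}\}_k$ is an orthonormal set in $L^2_{r^{d-1}}([0,1])=\{g\colon[0,1]\to\mathbb{C}\text{ measurable}:\int_0^1|g(r)|^2r^{d-1}\,dr<\infty\}$ with inner product $\int_0^1 g\,\overline{h}\,r^{d-1}\,dr$. (iii) Each $g_{n,k}(r)$ is defined and continuous at $r=1$. (iv) $\inf_{n,k}|g_{n,k}(1)|>0$. (v) $\psi_{n,k}(r\theta)=g_{n,k}(r)f_n(\theta)$, and there are scalars $a_{n,k}$ such that $\|\psi_{n,k}\|_{L^\infty(U)}\le a_{n,k}$ for all $n,k$, in a spherical shell $U=\{x: 1-\eta\le|x|\le 1\}$ for some (arbitrarily small) $\eta>0$ independent of $n,k$. For fixed $k$, let $W_k=\overline{\operatorname{span}\{\psi_{n,k}\}_n}$ (closure in $L^2(B)$) and $$\mathcal{A}_k=\Bigl\{f\in W_k : \sum_n|c_n|a_{n,k}<\infty\text{ where }c_n=\langle f,\psi_{n,k}\rangle_{L^2(B)}\Bigr\}.$$ *)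

(* Defs.v *)
From HB Require Import structures.
From mathcomp Require Import all_boot all_order all_algebra.
From mathcomp Require Import all_classical all_reals all_analysis.
From mathcomp Require Import measurable_realfun complex.
Set Implicit Arguments. Unset Strict Implicit. Unset Printing Implicit Defensive.
Import Order.TTheory GRing.Theory Num.Theory numFieldNormedType.Exports.
Import ComplexField.Normc.
Local Open Scope classical_set_scope.
Local Open Scope ring_scope.

(* [ 'rV[R]_n ] carries the sigma-algebra generated by the coordinates, which
   is its Borel sigma-algebra. *)
Definition rV_display : measure_display -> measure_display.
Proof. exact. Qed.

Section rV_measurable.
Variables (R : realType) (n : nat).

Definition rV_measurable : set (set 'rV[R]_n) :=
  g_sigma_preimage (fun i (x : 'rV[R]_n) => x 0 i).

Let rV_measurable0 : rV_measurable set0.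
Proof. exact: sigma_algebra0. Qed.

Let rV_measurableC A : rV_measurable A -> rV_measurable (~` A).
Proof. exact: sigma_algebraC. Qed.

Let rV_measurable_bigcup (F : (set 'rV[R]_n)^nat) :
  (forall i, rV_measurable (F i)) -> rV_measurable (\bigcup_i F i).
Proof. exact: sigma_algebra_bigcup. Qed.

HB.instance Definition _ :=
  @isMeasurable.Build (rV_display default_measure_display) 'rV[R]_n
    rV_measurable rV_measurable0 rV_measurableC rV_measurable_bigcup.

End rV_measurable.

Lemma measurable_coord (R : realType) (n : nat) (i : 'I_n) :
  measurable_fun [set: 'rV[R]_n] (fun x : 'rV[R]_n => x 0 i).
Proof.
move=> _ Y mY; rewrite setTI; apply: sub_sigma_algebra => /=.
rewrite -bigcup_seq/=; exists i => /=; first by rewrite mem_index_enum.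
by exists Y => //; rewrite setTI.
Qed.

Lemma measurable_fun_coordP d (T : measurableType d) (R : realType) (n : nat)
    (f : T -> 'rV[R]_n) :
  (forall i, measurable_fun [set: T] (fun t => f t 0 i)) ->
  measurable_fun [set: T] f.
Proof.
move=> mf.
have sub : g_sigma_preimage (fun i t => f t 0 i) `<=` @measurable _ T.
  apply: smallest_sub; first exact: sigma_algebra_measurable.
  rewrite -bigcup_seq; apply: bigcup_sub => i _ A [B mB <-].
  exact: mf.
move=> _ A mA; rewrite setTI; apply: sub.
rewrite (@g_sigma_preimage_comp _ _ _ _ (fun i (x : 'rV[R]_n) => x 0 i) _ f).
by exists A => //; rewrite setTI.
Qed.

Section lebesgue_rV.
Variable R : realType.

Definition rV_cons (n : nat) (p : measurableTypeR R * 'rV[R]_n) : 'rV[R]_n.+1 :=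
  \row_i oapp (p.2 0) p.1 (unlift ord0 i).

Lemma measurable_rV_cons n : measurable_fun setT (@rV_cons n).
Proof.
apply: measurable_fun_coordP => i; rewrite /rV_cons.
under eq_fun do rewrite mxE.
case: unliftP => [j _|_] /=.
  apply: (measurableT_comp (measurable_coord j)); exact: measurable_snd.
exact: measurable_fst.
Qed.

Section lebesgue_step.
Variables (n : nat) (mu : {sigma_finite_measure set 'rV[R]_n -> \bar R}).

Definition lebesgue_step : set 'rV[R]_n.+1 -> \bar R :=
  pushforward (lebesgue_measure \x mu)%E (@rV_cons n).

HB.instance Definition _ := Measure.copy lebesgue_step
  (measure_function_pushforward__canonical__measure_function_Measure
    (lebesgue_measure \x mu)%E (@measurable_rV_cons n)).

Let lebesgue_step_sigma_finite : sigma_finite setT lebesgue_step.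
Proof.
have /sigma_finiteP[F [TF ndF Foo]] :=
  @sigma_finiteT _ _ _ (@lebesgue_measure R).
have /sigma_finiteP[G [TG ndG Goo]] := sigma_finiteT mu.
pose g (x : 'rV[R]_n.+1) : measurableTypeR R * 'rV[R]_n :=
  (x 0 ord0, \row_j x 0 (lift ord0 j)).
have mg : measurable_fun setT g.
  apply/measurable_fun_pairP; split; first exact: measurable_coord.
  apply: measurable_fun_coordP => i.
  under eq_fun do rewrite mxE; exact: measurable_coord.
have gK p : g (rV_cons p) = p.
  rewrite /g /rV_cons mxE unlift_none /=; case: p => a v /=; congr pair.
  by apply/rowP => j; rewrite !mxE liftK.
exists (fun k => g @^-1` (F k `*` G k)).
  rewrite -preimage_bigcup (_ : \bigcup_k _ = setT) ?preimage_setT//.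
  apply/seteqP; split=> // -[x y] _.
  have [i _ Fix] : (\bigcup_i F i) x by rewrite -TF.
  have [j _ Gjy] : (\bigcup_j G j) y by rewrite -TG.
  exists (maxn i j) => //; split => /=.
    by move: Fix; exact/subsetPset/ndF/leq_maxl.
  by move: Gjy; exact/subsetPset/ndG/leq_maxr.
move=> k; have [? ?] := Foo k; have [? ?] := Goo k; split.
  by rewrite -[X in measurable X]setTI; apply: mg => //; exact: measurableX.
rewrite /lebesgue_step /pushforward -comp_preimage.
rewrite (_ : g \o _ = id); last exact/funext.
by rewrite product_measure1E// lte_mul_pinfty// ge0_fin_numE.
Qed.

HB.instance Definition _ :=
  @Measure_isSigmaFinite.Build _ _ _ lebesgue_step lebesgue_step_sigma_finite.

End lebesgue_step.

(* n-dimensional Lebesgue measure, as an iterated product measure. *)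
Fixpoint lebesgue_rV (n : nat) : {sigma_finite_measure set 'rV[R]_n -> \bar R} :=
  match n with
  | 0 => \d_(0 : 'rV[R]_0) : {sigma_finite_measure set _ -> \bar R}
  | m.+1 => lebesgue_step (lebesgue_rV m)
  end.

End lebesgue_rV.
Arguments lebesgue_rV : clear implicits.

Section euclidean.
Variables (R : realType) (d : nat).
Implicit Types x : 'rV[R]_d.

(* The library norm of ['rV[R]_d] is the sup norm, hence a separate definition. *)
Definition enorm x : R := Num.sqrt (\sum_i x 0 i ^+ 2).

Definition uball : set 'rV[R]_d := [set x | enorm x < 1].
Definition cuball : set 'rV[R]_d := [set x | enorm x <= 1].
Definition usphere : set 'rV[R]_d := [set x | enorm x = 1].
Definition shell (eta : R) : set 'rV[R]_d := [set x | 1 - eta <= enorm x <= 1].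

Definition direction x : 'rV[R]_d := (enorm x)^-1 *: x.

Lemma measurable_enorm : measurable_fun setT enorm.
Proof.
rewrite (_ : enorm = (fun x => (\sum_i x 0 i ^+ 2) `^ 2^-1)); last first.
  by apply/funext => x; rewrite powR12_sqrt// sumr_ge0// => i _; exact: sqr_ge0.
apply: (measurableT_comp (measurable_powR _)).
apply: measurable_sum => i; apply: measurable_funX; exact: measurable_coord.
Qed.

Lemma measurable_uball : measurable uball.
Proof.
rewrite -[X in measurable X]setTI.
rewrite (_ : uball = enorm @^-1` `]-oo, 1[); last first.
  by apply/seteqP; split => x; rewrite /uball/= in_itv.
exact: measurable_enorm.
Qed.

Lemma measurable_direction : measurable_fun setT direction.
Proof.
apply: measurable_fun_coordP => i; rewrite /direction.
under eq_fun do rewrite mxE -powR_inv1 ?sqrtr_ge0//.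
apply: measurable_funM; last exact: measurable_coord.
exact: (measurableT_comp (measurable_powR _) measurable_enorm).
Qed.

End euclidean.
Arguments uball : clear implicits.
Arguments cuball : clear implicits.
Arguments usphere : clear implicits.
Arguments measurable_uball : clear implicits.
Arguments measurable_direction : clear implicits.

(* Surface measure of the unit sphere, as a measure on R^d carried by the sphere:
   |A| is d times the Lebesgue measure of the cone {r theta | 0 < r < 1, theta in A}. *)
Section surface_measure.
Variables (R : realType) (d : nat).

Definition surface : set 'rV[R]_d -> \bar R :=
  pushforward (mscale (d%:R)%:nng
    (mrestr (lebesgue_rV R d) (measurable_uball R d))) (@direction R d).

HB.instance Definition _ := Measure.copy surface
  (measure_function_pushforward__canonical__measure_function_Measure
    (mscale (d%:R)%:nng (mrestr (lebesgue_rV R d) (measurable_uball R d)))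
    (measurable_direction R d)).

End surface_measure.
Arguments surface : clear implicits.

(* Spaces of complex-valued functions. Their elements are represented by functions
   defined on the whole type, of which only the values on D matter. *)
Section complex_functions.
Context disp (T : measurableType disp) (R : realType).
Variables (mu : {measure set T -> \bar R}) (D : set T).
Implicit Types f g : T -> R[i].

Definition cmeasurable f :=
  measurable_fun D (fun x => complex.Re (f x)) /\
  measurable_fun D (fun x => complex.Im (f x)).

Definition cnorm (p : \bar R) f : \bar R :=
  ('N[mu]_p [ (fun x => (normc (f x))%:E) \_ D ])%E.

Definition L2 f := cmeasurable f /\ (cnorm 2%:E f < +oo)%E.

Definition cintegral f : R[i] :=
  (Rintegral mu D (fun x => complex.Re (f x)) +i*
   Rintegral mu D (fun x => complex.Im (f x)))%C.

Definition inner f g : R[i] := cintegral (fun x => f x * (g x)^*%C).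

Definition orthonormal_family (I : eqType) (f : I -> T -> R[i]) :=
  (forall i, L2 (f i)) /\ (forall i j, inner (f i) (f j) = (i == j)%:R).

Definition closed_span (I : Type) (f : I -> T -> R[i]) (h : T -> R[i]) :=
  L2 h /\ forall eps : R, 0 < eps -> exists (s : seq I) (c : I -> R[i]),
    (cnorm 2%:E (fun x => (h x - \sum_(i <- s) c i * f i x)%R) < eps%:E)%E.

Definition orthonormal_basis (I : eqType) (f : I -> T -> R[i]) :=
  orthonormal_family f /\ (forall h, L2 h -> closed_span f h).

End complex_functions.

(* L^2([0,1]; r^(d-1) dr) *)
Section radial.
Variables (R : realType) (d : nat).
Local Notation leb := (@lebesgue_measure R).
Local Notation I01 := (`[0%R, 1%R]%classic : set (measurableTypeR R)).
Implicit Types g h : R -> R[i].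

Definition radial_L2 g :=
  cmeasurable I01 g /\
  (\int[leb]_(r in I01) (normc (g r) ^+ 2 * r ^+ d.-1)%:E < +oo)%E.

Definition radial_inner g h : R[i] :=
  cintegral leb I01 (fun r => g r * (h r)^*%C * (r ^+ d.-1)%:C%C).

Definition radial_orthonormal (K : eqType) (g : K -> R -> R[i]) :=
  (forall k, radial_L2 (g k)) /\
  (forall k l, radial_inner (g k) (g l) = (k == l)%:R).

End radial.

Section sobolev.
Variables (R : realType) (d : nat).
Local Notation E := 'rV[R]_d.
Local Notation B := (uball R d).
Local Notation dB := (usphere R d).
Local Notation leb := (lebesgue_rV R d).
Local Notation sigma := (surface R d).
Implicit Types (u v h w : E -> R[i]) (phi : E -> R).

Definition partial (i : 'I_d) phi : E -> R := 'D_(delta_mx 0 i : E) phi.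

Definition smooth phi := forall s : seq 'I_d,
  let psi := foldr partial phi s in
  continuous psi /\ forall i x, derivable psi x (delta_mx 0 i).

Definition csmooth u :=
  smooth (fun x => complex.Re (u x)) /\ smooth (fun x => complex.Im (u x)).

(* C_c^oo(B); real test functions suffice, by linearity. *)
Definition test_function phi :=
  smooth phi /\ closure [set x | phi x != 0] `<=` B.

Definition weak_partial (i : 'I_d) u v := forall phi, test_function phi ->
  cintegral leb B (fun x => u x * (partial i phi x)%:C%C) =
  - cintegral leb B (fun x => v x * (phi x)%:C%C).

Definition H1 u := L2 leb B u /\
  forall i, exists v, L2 leb B v /\ weak_partial i u v.

(* The weak partial derivative of u in L^2(B) (unique a.e.), when it exists. *)
Definition wpartial (i : 'I_d) u : E -> R[i] :=
  xget (cst 0) [set v | L2 leb B v /\ weak_partial i u v].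

Definition H1_norm u : \bar R :=
  ((cnorm leb B 2%:E u ^+ 2 +
    \sum_(i < d) cnorm leb B 2%:E (wpartial i u) ^+ 2) `^ 2^-1)%E.

(* h = u|_dB: the trace operator is the continuous extension to H^1(B) of the
   restriction to dB of functions smooth up to the boundary, so its graph is the
   closure of the graph of that restriction in H^1(B) x L^2(dB). *)
Definition is_trace u h := [/\ H1 u, L2 sigma dB h &
  forall eps : R, 0 < eps -> exists2 phi, csmooth phi &
    (H1_norm (fun x => (phi x - u x)%R) < eps%:E)%E /\
    (cnorm sigma dB 2%:E (fun x => (phi x - h x)%R) < eps%:E)%E].

(* H^{1/2}(dB) is the trace space of H^1(B), with the quotient norm. *)
Definition H12 h := exists u, is_trace u h.

Definition H12_norm h : \bar R :=
  ereal_inf [set H1_norm u | u in [set u | is_trace u h]].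

(* H^{-1/2}(dB) is the dual of H^{1/2}(dB); this is the dual norm. *)
Definition Hm12_norm (l : (E -> R[i]) -> R[i]) : \bar R :=
  ereal_sup [set (normc (l w))%:E | w in [set w | H12 w /\ (H12_norm w <= 1)%E]].

(* The norm of L(H^{1/2}(dB), H^{-1/2}(dB)). *)
Definition op_norm (L : (E -> R[i]) -> (E -> R[i]) -> R[i]) : \bar R :=
  ereal_sup [set Hm12_norm (L h) | h in [set h | H12 h /\ (H12_norm h <= 1)%E]].

(* C_+(closure of B); the infimum is a minimum, by compactness. *)
Definition conductivity (gamma : E -> R) :=
  {within cuball R d, continuous gamma} /\ 0 < inf (gamma @` cuball R d).

Definition weak_solution (gamma : E -> R) u := forall phi, test_function phi ->
  \sum_(i < d) cintegral leb B
    (fun x => (gamma x)%:C%C * wpartial i u x * (partial i phi x)%:C%C) = 0.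

(* The solution with Dirichlet data h, and an H^1 extension of w. *)
Definition dirichlet_solution (gamma : E -> R) h : E -> R[i] :=
  xget (cst 0) [set u | is_trace u h /\ weak_solution gamma u].

Definition extension w : E -> R[i] := xget (cst 0) [set v | is_trace v w].

(* The conormal derivative nu . (gamma grad u) of a solution u is the element of
   H^{-1/2}(dB) whose value at w is the integral over B of gamma grad u . grad v,
   for any v in H^1(B) with trace w. *)
Definition DN (gamma : E -> R) h w : R[i] :=
  \sum_(i < d) cintegral leb B (fun x => (gamma x)%:C%C *
    wpartial i (dirichlet_solution gamma h) x * wpartial i (extension w) x).

Definition DN_dist (gamma1 gamma2 : E -> R) : \bar R :=
  op_norm (fun h w => DN gamma1 h w - DN gamma2 h w).

(* C bounds |gamma1 - gamma2| on dB by the distance of the DN maps. *)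
Definition boundary_stability (C : R) := forall gamma1 gamma2 : E -> R,
  conductivity gamma1 -> conductivity gamma2 ->
  (cnorm sigma dB +oo (fun x => (gamma1 x - gamma2 x)%:C%C)
     <= C%:E * DN_dist gamma1 gamma2)%E.

Section expansion.
Variables (N K : countType) (f : N -> E -> R[i]) (g : N -> K -> R -> R[i]).

Definition psi (n : N) (k : K) (x : E) : R[i] :=
  g n k (enorm x) * f n (direction x).

Definition W_space (k : K) : set (E -> R[i]) :=
  closed_span leb B (fun n => psi n k).

Definition A_space (a : N -> K -> R) (k : K) : set (E -> R[i]) :=
  [set F | W_space k F /\
    (\esum_(n in [set: N]) (normc (inner leb B F (psi n k)) * a n k)%:E < +oo)%E].

End expansion.

End sobolev.

(* Main.v *)
(* Write F = gamma1 - gamma2 and c_n = <F, psi_n>. Testing F against f_n on thin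
   shells 1 - t <= |x| < 1 gives <F, f_n>_{dB} = g_n(1) c_n as t -> 0: F is
   uniformly close to its boundary values there, g_n is continuous at 1, and F
   is orthogonal to everything orthogonal to all the psi_n. The psi_n are
   orthonormal (polar coordinates), so Parseval in the ball and Bessel on the
   sphere give inf |g_n(1)|^2 ||F||_B^2 <= ||F||_{dB}^2, and the latter is at
   most |dB| ||F||_{L^oo(dB)}^2, which boundary stability controls. *)
From HB Require Import structures.
Require Import Defs.
From mathcomp Require Import all_boot all_order all_algebra.
From mathcomp Require Import all_classical all_reals all_analysis.
From mathcomp Require Import measurable_realfun ess_sup_inf complex ring lra.
Import Order.TTheory GRing.Theory Num.Theory numFieldNormedType.Exports.
Import ComplexField.Normc.
Set Implicit Arguments. Unset Strict Implicit. Unset Printing Implicit Defensive.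
Local Open Scope classical_set_scope.
Local Open Scope ring_scope.

(** * Measures with a density *)

(** Membership in [W_space] only gives approximation in L^2(B), and L^2(B) does not see values on
    the sphere. Boundary coefficients are therefore never read off an expansion of F. A shell
    average is an L^2(B) inner product, and continuity of F up to the sphere is what ties it to a
    boundary coefficient. The shell indicator times f_n is orthogonal to psi_j for every j other
    than n, so no series is summed or exchanged with a limit; Parseval enters only through finite
    sums, up to an arbitrary epsilon. The errors made on a shell are proportional to its mass, which
    is why dividing by that mass is harmless however thin the shell is. Polar coordinates come from
    scaling: [surface] is defined through cones, and a cone truncated at radius s has s^d times the
    measure of the one truncated at radius 1. Agreement on such cones determines the image
    measure. *)

Section density.
Local Open Scope ereal_scope.
Context dT (T : measurableType dT) (R : realType).
Variables (mu nu : {measure set T -> \bar R}) (w : T -> R).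
Hypotheses (mw : measurable_fun setT w) (w_ge0 : forall x, (0 <= w x)%R).
Hypothesis nuE : forall A, measurable A -> nu A = \int[mu]_(x in A) (w x)%:E.

Import HBNNSimple.

(** On indicators this is [nuE]; nonnegative simple functions follow by linearity and the general
    case by monotone convergence. It serves with the indicator of the ball and with the radial
    weight as density. *)
Lemma ge0_integral_density (f : T -> \bar R) :
  measurable_fun setT f -> (forall x, 0 <= f x) ->
  \int[nu]_x f x = \int[mu]_x (f x * (w x)%:E).
Proof.
move=> mf f0; pose f_ := nnsfun_approx measurableT mf.
have wE0 x : 0 <= (w x)%:E by rewrite lee_fin.
have mwE : measurable_fun setT (EFin \o w) by exact/measurable_EFinP.
have cvf x : (f_ n x)%:E @[n --> \oo] --> f x.
  by apply: cvg_nnsfun_approx.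
have ind (h : {nnsfun T >-> R}) :
    \int[nu]_x (h x)%:E = \int[mu]_x ((h x)%:E * (w x)%:E).
  under [LHS]eq_integral do rewrite fimfunE -fsumEFin//.
  rewrite [LHS]ge0_integral_fsum//; last 2 first.
    - by move=> r; exact/measurable_EFinP/measurableT_comp.
    - by move=> n x _; rewrite EFinM nnfun_muleindic_ge0.
  under [RHS]eq_integral.
    move=> x xD; rewrite fimfunE -fsumEFin// ge0_mule_fsuml; last first.
      by move=> r; rewrite EFinM nnfun_muleindic_ge0.
    over.
  rewrite [RHS]ge0_integral_fsum//; last 2 first.
    - move=> r; apply: emeasurable_funM => //.
      by apply/measurable_EFinP; apply/measurableT_comp.
    - by move=> n x _; rewrite mule_ge0// EFinM nnfun_muleindic_ge0.
  apply: eq_fsbigr => r rh.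
  have r0 : (0 <= r)%R by case/set_mem: rh => x _ rE; rewrite -rE.
  under eq_integral do rewrite EFinM.
  under [RHS]eq_integral do rewrite EFinM -muleA.
  rewrite ge0_integralZl//; last exact/measurable_EFinP.
  rewrite ge0_integralZl//; last 2 first.
    - by apply: emeasurable_funM => //; exact/measurable_EFinP.
    - by move=> x _; rewrite mule_ge0// lee_fin.
  congr (_ * _).
  rewrite integral_indic// setIT nuE// integral_mkcond.
  apply: eq_integral => x _; rewrite patchE indicE.
  by case: (x \in _); rewrite ?mul1e ?mul0e.
transitivity (limn (fun n => \int[nu]_x (f_ n x)%:E)).
  rewrite -monotone_convergence//=.
  - apply: eq_integral => x _; apply/esym/cvg_lim => //=.
  - by move=> n; exact/measurable_EFinP/measurable_funTS.
  - by move=> n x _; rewrite lee_fin.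
  - by move=> x _ a b ab; rewrite lee_fin//; exact/lefP/nd_nnsfun_approx.
under eq_fun do rewrite ind.
rewrite -monotone_convergence//=.
- apply: eq_integral => x _; apply/cvg_lim => //=.
  by apply: cvgeZr => //; exact: cvf.
- move=> n; apply: emeasurable_funM => //.
  exact/measurable_EFinP/measurable_funTS.
- by move=> n x _; rewrite mule_ge0// lee_fin.
- move=> x _ a b ab; rewrite lee_wpmul2r//.
  by rewrite lee_fin; exact/lefP/nd_nnsfun_approx.
Qed.

Lemma integrable_density (f : T -> R) : measurable_fun setT f ->
  mu.-integrable setT (fun x => (f x * w x)%:E) ->
  nu.-integrable setT (EFin \o f).
Proof.
move=> mf /integrableP[mfw ifw]; apply/integrableP; split.
  exact/measurable_EFinP.
rewrite ge0_integral_density//; last first.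
  by apply: measurableT_comp => //; exact/measurable_EFinP.
apply: le_lt_trans ifw; rewrite le_eqVlt; apply/orP; left; apply/eqP.
by apply: eq_integral => x _ /=; rewrite normrM EFinM (ger0_norm (w_ge0 x)).
Qed.

Lemma integral_density (f : T -> R) : measurable_fun setT f ->
  \int[nu]_x (f x)%:E = \int[mu]_x (f x * w x)%:E.
Proof.
move=> mf; rewrite integralE [RHS]integralE.
rewrite !ge0_integral_density//; last 2 first.
  - by apply: measurable_funeneg; exact/measurable_EFinP.
  - by apply: measurable_funepos; exact/measurable_EFinP.
by congr (_ - _); apply: eq_integral => x _; rewrite ?funeposE ?funenegE/= -?EFinN;
  rewrite -!EFin_max -EFinM maxr_pMl// mul0r ?mulNr.
Qed.

End density.

(** * Lebesgue measure on R^n *)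

Section scaling.
Variable R : realType.
Local Open Scope ereal_scope.

Lemma measurable_scale_rV n (s : R) :
  measurable_fun setT (fun x : 'rV[R]_n => (s *: x)%R).
Proof.
apply: measurable_fun_coordP => i; under eq_fun do rewrite mxE.
by apply: measurable_funM => //; exact: measurable_coord.
Qed.

(** The pushforward under multiplication by s, times s, gives ]a, b] its length, and this
    characterizes Lebesgue measure. *)
Lemma lebesgue_measure_scale (s : R) (A : set (measurableTypeR R)) :
  (0 < s)%R -> measurable A ->
  lebesgue_measure
    ((fun x : measurableTypeR R => (s * x)%R : measurableTypeR R) @^-1` A)
    = s^-1%:E * lebesgue_measure A.
Proof.
move=> s0 mA.
have ms : measurable_fun setT
    (fun x : measurableTypeR R => (s * x)%R : measurableTypeR R).
  exact: measurable_funM.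
pose m := mscale (NngNum (ltW s0))
  (measure_function_pushforward__canonical__measure_function_Measure
    (@lebesgue_measure R) ms).
suff -> : lebesgue_measure A = m A.
  by rewrite /m/= /mscale/= muleA -EFinM mulVf ?gt_eqF// mul1e.
apply: lebesgue_measure_unique => // X [[a b] _ <-].
rewrite /m/= /mscale/= /pushforward.
rewrite (_ : _ @^-1` _ = `](s^-1 * a)%R, (s^-1 * b)%R]%classic); last first.
  apply/seteqP; split=> x /=; rewrite !in_itv/= ler_pdivlMl// ltr_pdivrMl//.
rewrite !lebesgue_measure_itv/= !lte_fin ltr_pM2l ?invr_gt0//.
case: ifPn => _; last by rewrite mule0.
by rewrite -!EFinD -EFinM -mulrBr mulrA mulfV ?mul1r// gt_eqF.
Qed.

(** Induction along the iterated product, each coordinate contributing a factor 1/s. The pushforward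
    under scaling, times s^(n+1), agrees with the product measure on rectangles, hence
    everywhere. *)
Lemma lebesgue_rV_scale n (s : R) (A : set 'rV[R]_n) :
  (0 < s)%R -> measurable A ->
  lebesgue_rV R n ((fun x => (s *: x)%R) @^-1` A)
    = (s ^- n)%:E * lebesgue_rV R n A.
Proof.
move=> s0; elim: n A => [|n IH] A mA.
  rewrite expr0 invr1 mul1e; congr (lebesgue_rV R 0 _).
  by apply/seteqP; split=> x /=; rewrite [(s *: x)%R]thinmx0 [x]thinmx0.
pose S (p : measurableTypeR R * 'rV[R]_n) : measurableTypeR R * 'rV[R]_n :=
  ((s * p.1)%R, (s *: p.2)%R).
have mS : measurable_fun setT S.
  apply/measurable_fun_pairP; split => /=.
    by apply: measurable_funM => //; exact: measurable_fst.
  exact: (measurableT_comp (measurable_scale_rV s) measurable_snd).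
have sn0 : (0 <= s ^+ n.+1)%R by rewrite exprn_ge0// ltW.
pose m := mscale (NngNum sn0)
  (measure_function_pushforward__canonical__measure_function_Measure
    (lebesgue_measure \x lebesgue_rV R n) mS).
rewrite /= /lebesgue_step /pushforward.
have mB : measurable (@rV_cons R n @^-1` A).
  by rewrite -[X in measurable X]setTI; exact: measurable_rV_cons.
have consS p : (s *: rV_cons p)%R = rV_cons (S p).
  by apply/rowP => i; rewrite !mxE; case: unliftP => [j _|_] /=; rewrite ?mxE.
have -> : @rV_cons R n @^-1` ((fun x => (s *: x)%R) @^-1` A) =
    S @^-1` (@rV_cons R n @^-1` A).
  by apply/seteqP; split => p /=; rewrite consS.
have := @product_measure_unique _ _ _ _ _ lebesgue_measure (lebesgue_rV R n) m.
move=> /(_ _ _ mB) ->; last first.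
  move=> B C mB' mC; rewrite /m/= /mscale/= /pushforward.
  rewrite (_ : S @^-1` _ =
    ((fun x => s * x)%R @^-1` B) `*` ((fun x => (s *: x)%R) @^-1` C))//.
  rewrite product_measure1E; last 2 first.
    - rewrite -[X in measurable X]setTI; exact: measurable_funM.
    - rewrite -[X in measurable X]setTI; exact: measurable_scale_rV.
  rewrite IH// [X in _ * (X * _)](lebesgue_measure_scale s0 mB').
  rewrite muleACA -EFinM -invfM -exprS !muleA -EFinM mulfV ?mul1e//.
  by rewrite gt_eqF// exprn_gt0.
rewrite /m/= /mscale/= /pushforward muleA -EFinM mulVf ?mul1e//.
by rewrite gt_eqF// exprn_gt0.
Qed.

End scaling.

(** * The Euclidean norm and the radial projection onto the sphere *)

Section euclidean_geometry.
Variables (R : realType) (d : nat).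
Implicit Types x : 'rV[R]_d.

Lemma enorm_ge0 x : 0 <= enorm x.
Proof. exact: sqrtr_ge0. Qed.

Lemma sqr_enorm x : enorm x ^+ 2 = \sum_i x 0 i ^+ 2.
Proof. by rewrite sqr_sqrtr// sumr_ge0// => i _; exact: sqr_ge0. Qed.

Lemma enormZ (s : R) x : enorm (s *: x) = `|s| * enorm x.
Proof.
rewrite /enorm -sqrtr_sqr -sqrtrM ?sqr_ge0//; congr Num.sqrt.
by rewrite mulr_sumr; apply: eq_bigr => i _; rewrite mxE exprMn.
Qed.

Lemma coord_le_enorm x i : `|x 0 i| <= enorm x.
Proof.
rewrite -sqrtr_sqr ler_wsqrtr// (bigD1 i)//= lerDl sumr_ge0// => j _.
exact: sqr_ge0.
Qed.

Lemma enorm_eq0 x : (enorm x == 0) = (x == 0).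
Proof.
apply/eqP/eqP => [x0|->]; last first.
  by rewrite /enorm big1 ?sqrtr0// => i _; rewrite mxE expr0n.
apply/rowP => i; rewrite mxE; apply/eqP; rewrite -normr_le0 -x0.
exact: coord_le_enorm.
Qed.

Lemma enorm0 : enorm (0 : 'rV[R]_d) = 0.
Proof. by apply/eqP; rewrite enorm_eq0. Qed.

Lemma enorm_gt0 x : (0 < enorm x) = (x != 0).
Proof. by rewrite lt0r enorm_ge0 andbT enorm_eq0. Qed.

Lemma directionZ (s : R) x : 0 < s -> direction (s *: x) = direction x.
Proof.
move=> s0; rewrite /direction enormZ gtr0_norm// scalerA invfM mulrAC mulVf//.
  by rewrite mul1r.
by rewrite gt_eqF.
Qed.

Lemma enorm_direction x : x != 0 -> enorm (direction x) = 1.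
Proof.
move=> x0; rewrite /direction enormZ ger0_norm ?invr_ge0 ?enorm_ge0//.
by rewrite mulVf// enorm_eq0.
Qed.

Lemma scale_direction x : x = enorm x *: direction x.
Proof.
have [->|x0] := eqVneq x 0; first by rewrite enorm0 scale0r.
by rewrite /direction scalerA mulfV ?scale1r// enorm_eq0.
Qed.

Lemma direction_usphere x : x != 0 -> usphere R d (direction x).
Proof. exact: enorm_direction. Qed.

Lemma measurable_rV0 : measurable [set 0 : 'rV[R]_d].
Proof.
rewrite (_ : [set _] = @enorm R d @^-1` [set 0]); last first.
  by apply/seteqP; split => x /=; [move=> ->; rewrite enorm0|
    move/eqP; rewrite enorm_eq0 => /eqP].
by rewrite -[X in measurable X]setTI; exact: measurable_enorm.
Qed.

Lemma measurable_usphere : measurable (usphere R d).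
Proof.
rewrite (_ : usphere R d = @enorm R d @^-1` [set 1]) //.
by rewrite -[X in measurable X]setTI; exact: measurable_enorm.
Qed.

End euclidean_geometry.

(** * Lebesgue measure of the ball, of the origin and of cones *)

Section lebesgue_uball.
Variable R : realType.
Local Open Scope ereal_scope.

(** The ball of dimension n+1 lies in [-1, 1] times the ball of dimension n. Finiteness of [surface]
    follows from this. *)
Lemma lebesgue_rV_uball_lty n : lebesgue_rV R n (uball R n) < +oo.
Proof.
elim: n => [|n IH].
  by rewrite /= diracE; case: (_ \in _); rewrite ltry.
pose J := `[(-1)%R, 1%R]%classic : set (measurableTypeR R).
apply: (@le_lt_trans _ _ ((lebesgue_measure \x lebesgue_rV R n) (J `*` uball R n))).
  rewrite -[leLHS]/((lebesgue_measure \x lebesgue_rV R n)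
    (@rV_cons R n @^-1` uball R n.+1)).
  apply: le_measure.
  - rewrite inE -[X in measurable X]setTI; apply: measurable_rV_cons => //.
    exact: measurable_uball.
  - by rewrite inE; apply: measurableX;
      [exact: measurable_itv|exact: measurable_uball].
  move=> [a x] /= ax1.
  have a1 : (`|a| <= enorm (rV_cons (a, x)))%R.
    by have := coord_le_enorm (rV_cons (a, x)) ord0; rewrite mxE unlift_none.
  have x1 : (enorm x <= enorm (rV_cons (a, x)))%R.
    rewrite ler_wsqrtr// big_ord_recl.
    under [X in (_ <= _ + X)%R]eq_bigr do rewrite mxE liftK/=.
    by rewrite lerDr sqr_ge0.
  split => /=; last exact: le_lt_trans x1 ax1.
  by rewrite /J/= in_itv/= -ler_norml (le_trans a1)// ltW.
rewrite product_measure1E; [|exact: measurable_itv|exact: measurable_uball].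
rewrite lte_mul_pinfty// ge0_fin_numE// /J.
rewrite [ltLHS]lebesgue_measure_itv/=.
by case: ifP => // _; rewrite -EFinD ltry.
Qed.

(** The origin has to be negligible because [direction 0 = 0] is not on the sphere. In dimension 0
    the measure is a Dirac mass, hence the successor. *)
Lemma lebesgue_rV_set0 n : lebesgue_rV R n.+1 [set 0%R] = 0.
Proof.
rewrite /= /lebesgue_step /pushforward.
rewrite (_ : _ @^-1` _ = [set 0%R] `*` [set 0%R]); last first.
  apply/seteqP; split => -[a x] /= => [/rowP ax0|[-> ->]].
    split; first by have := ax0 ord0; rewrite !mxE unlift_none.
    by apply/rowP => i; have := ax0 (lift ord0 i); rewrite !mxE liftK.
  by apply/rowP => i; rewrite !mxE; case: unliftP => //= j _; rewrite mxE.
rewrite product_measure1E; [|exact: measurable_set1|exact: measurable_rV0].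
by rewrite [X in X * _]lebesgue_measure_set1 mul0e.
Qed.

(** [direction] is invariant under positive scaling, so the cone truncated at radius s is the
    dilation by s of the one truncated at 1. This is where the radial density r^(d-1) comes from. *)
Lemma lebesgue_rV_cone n (s : R) (A : set 'rV[R]_n) : measurable A ->
  (0 < s)%R ->
  lebesgue_rV R n ([set x | (enorm x < s)%R] `&` @direction R n @^-1` A) =
  (s ^+ n)%:E * lebesgue_rV R n (uball R n `&` @direction R n @^-1` A).
Proof.
move=> mA s0; set X := _ `&` _.
have mX : measurable X.
  apply: measurableI; last first.
    by rewrite -[X in measurable X]setTI; exact: measurable_direction.
  rewrite -[X in measurable X]setTI.
  rewrite (_ : [set x | _] = @enorm R n @^-1` `]-oo, s[).
    exact: measurable_enorm.
  by apply/seteqP; split => x; rewrite /= in_itv.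
have := lebesgue_rV_scale s0 mX.
rewrite (_ : _ @^-1` X = uball R n `&` @direction R n @^-1` A) => [->|].
  by rewrite muleA -EFinM mulfV ?mul1e// gt_eqF// exprn_gt0.
apply/seteqP; split => x; rewrite /X/uball/= directionZ// enormZ gtr0_norm//;
  by rewrite gtr_pMr.
Qed.

End lebesgue_uball.

(** * Polar coordinates *)

Section radial_measure.
Variables (R : realType) (n : nat).
Local Notation leb := (@lebesgue_measure R).
Local Notation I01 := (`[0%R, 1%R]%classic : set (measurableTypeR R)).
Local Open Scope ereal_scope.

Lemma integral_exprn (s : R) : (0 <= s)%R ->
  \int[leb]_(r in `[0%R, s]) (r ^+ n)%:E = (s ^+ n.+1 / n.+1%:R)%:E.
Proof.
rewrite le_eqVlt => /predU1P[<-|s0].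
  by rewrite set_itv1 integral_set1 expr0n mul0r.
have dF (x : R) : is_derive x 1%R (fun r : R => r ^+ n.+1 / n.+1%:R)%R (x ^+ n)%R.
  have : is_derive x 1%R (fun r : R => r ^+ n.+1)%R (n.+1%:R * x ^+ n)%R.
    apply: DeriveDef; first exact: exprn_derivable.
    by rewrite exp_derive [LHS]mulr1.
  move=> dX; have := is_deriveM dX (is_derive_cst ((n.+1)%:R^-1 : R)%R x 1%R).
  rewrite scaler0 add0r => /is_derive_eq; apply.
  by rewrite /GRing.scale/= mulrA mulVf ?mul1r// pnatr_eq0.
have cF : continuous (fun r : R => r ^+ n.+1 / n.+1%:R)%R.
  by move=> x; apply: cvgMr_tmp; exact: exprn_continuous.
rewrite (@continuous_FTC2 _ _ (fun r : R => r ^+ n.+1 / n.+1%:R)%R)//.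
- by rewrite expr0n mul0r sube0.
- by apply: continuous_subspaceT; exact: exprn_continuous.
- split.
  + by move=> x _; have [] := dF x.
  + by apply: cvg_at_right_filter; exact: cF.
  + by apply: cvg_at_left_filter; exact: cF.
- by move=> x _; rewrite derive1E; have /@derive_val := dF x.
Qed.

(** The polar Jacobian r^(d-1), with n = d - 1. The cutoff to [0, 1] makes the measure with this
    density finite. *)
Definition radial_weight (r : R) : R := (r ^+ n * \1_I01 r)%R.

Lemma measurable_radial_weight : measurable_fun setT radial_weight.
Proof. by apply: measurable_funM => //; exact: measurable_indic. Qed.

Lemma radial_weight_ge0 r : (0 <= radial_weight r)%R.
Proof.
rewrite /radial_weight indicE; case: (boolP (r \in I01)) => [|_]; last by rewrite mulr0.
by rewrite inE/= in_itv/= mulr1 => /andP[? _]; rewrite exprn_ge0.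
Qed.

Lemma radial_weightE :
  (fun r : measurableTypeR R => (radial_weight r)%:E) = (fun r => (r ^+ n)%:E) \_ I01.
Proof.
apply/funext => r; rewrite /= /radial_weight patchE indicE.
by case: (r \in I01); rewrite ?mulr1 ?mulr0.
Qed.

Definition radial_measure (A : set (measurableTypeR R)) : \bar R :=
  \int[leb]_(r in A) (radial_weight r)%:E.

Let radial_measure0 : radial_measure set0 = 0.
Proof. exact: integral_set0. Qed.

Let radial_measure_ge0 A : 0 <= radial_measure A.
Proof. by apply: integral_ge0 => r _; rewrite lee_fin radial_weight_ge0. Qed.

Let radial_measure_additive : semi_sigma_additive radial_measure.
Proof.
apply: semi_sigma_additive_nng_induced.
  by apply/measurable_EFinP; exact: measurable_radial_weight.
by move=> r; rewrite lee_fin radial_weight_ge0.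
Qed.

HB.instance Definition _ := isMeasure.Build _ _ _ radial_measure
  radial_measure0 radial_measure_ge0 radial_measure_additive.

(** The rays ]-oo, s[ form a generating system closed under intersection, so these values identify
    the radial measure in [lebesgue_rV_polar]. *)
Lemma radial_measure_itv (s : R) : (0 < s)%R -> 
  radial_measure `]-oo, s[ = (Num.min s 1%R ^+ n.+1 / n.+1%:R)%R%:E.
Proof.
move=> s0; rewrite /radial_measure.
rewrite radial_weightE -integral_mkcondr; have [s1|s1] := leP s 1%R.
  rewrite (_ : _ `&` _ = `[0%R, s[%classic).
    rewrite integral_itv_bndo_bndc; last first.
      by apply/measurable_EFinP/measurable_funTS; exact: measurable_funX.
    by rewrite integral_exprn// ltW.
  apply/seteqP; split => x; rewrite /= !in_itv/=.
    by move=> [-> /andP[->]].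
  by move=> /andP[-> xs]; split => //=; rewrite ltW// (lt_le_trans xs).
rewrite (_ : _ `&` _ = I01); first by rewrite integral_exprn.
apply/setIidPr => x; rewrite /= !in_itv/= => /andP[_ x1].
exact: le_lt_trans s1.
Qed.

Lemma radial_measure_setT : radial_measure setT = (n.+1%:R^-1)%:E.
Proof.
rewrite /radial_measure.
by rewrite radial_weightE -integral_mkcondr setTI integral_exprn// expr1n mul1r.
Qed.

Let radial_measure_fin : fin_num_fun radial_measure.
Proof.
move=> A mA; rewrite ge0_fin_numE//.
apply: (@le_lt_trans _ _ (radial_measure setT)).
  by apply: le_measure; rewrite ?inE.
by rewrite radial_measure_setT ltry.
Qed.

HB.instance Definition _ := Measure_isFinite.Build _ _ _ radial_measure
  radial_measure_fin.

End radial_measure.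

Section polar.
Variables (R : realType) (n : nat).
Local Notation d := n.+1.
Local Notation leb := (@lebesgue_measure R).
Local Notation I01 := (`[0%R, 1%R]%classic : set (measurableTypeR R)).
Local Notation B := (uball R d).
Local Notation dB := (usphere R d).
Local Notation lam := (lebesgue_rV R d).
Local Notation sigma := (surface R d).
Local Notation nu := (@radial_measure R n).
Local Open Scope ereal_scope.

Lemma surfaceE (A : set 'rV[R]_d) :
  sigma A = (d%:R)%:E * lam (B `&` @direction R d @^-1` A).
Proof. by rewrite /surface/= /pushforward /mscale/= /mrestr setIC. Qed.

Let surface_fin : fin_num_fun sigma.
Proof.
move=> A mA; rewrite surfaceE fin_numM// ge0_fin_numE//.
apply: le_lt_trans (lebesgue_rV_uball_lty R d).
apply: le_measure; rewrite ?inE; last exact: subIsetl.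
  apply: measurableI; first exact: measurable_uball.
  by rewrite -[X in measurable X]setTI; exact: measurable_direction.
exact: measurable_uball.
Qed.

HB.instance Definition _ := Measure_isFinite.Build _ _ _ sigma surface_fin.

Definition polar_coord (x : 'rV[R]_d) : measurableTypeR R * 'rV[R]_d :=
  (enorm x, direction x).

Lemma measurable_polar_coord : measurable_fun setT polar_coord.
Proof.
apply/measurable_fun_pairP; split; first exact: measurable_enorm.
exact: measurable_direction.
Qed.

(** For fixed [A2] both sides are finite measures in [A1], called [m1] and [m2] below; it suffices
    to compare them on the rays ]-oo, s[. *)
Lemma lebesgue_rV_polar (A1 : set (measurableTypeR R)) (A2 : set 'rV[R]_d) :
  measurable A1 -> measurable A2 ->
  lam (B `&` polar_coord @^-1` (A1 `*` A2)) = nu A1 * sigma A2.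
Proof.
move=> mA1 mA2.
have mC : measurable (B `&` @direction R d @^-1` A2).
  apply: measurableI; first exact: measurable_uball.
  by rewrite -[X in measurable X]setTI; exact: measurable_direction.
have me : measurable_fun setT (@enorm R d : _ -> measurableTypeR R).
  exact: measurable_enorm.
have sA2 : (0 <= fine (sigma A2))%R by exact: fine_ge0.
pose m1 : {measure set (measurableTypeR R) -> \bar R} :=
  measure_function_pushforward__canonical__measure_function_Measure
    (mrestr lam mC) me.
pose m2 : {measure set (measurableTypeR R) -> \bar R} := mscale (NngNum sA2) nu.
have m2E A : m2 A = sigma A2 * nu A.
  by rewrite -[LHS]/((fine (sigma A2))%:E * nu A) fineK ?fin_num_measure.
have m1E A : m1 A = lam (@enorm R d @^-1` A `&` (B `&` @direction R d @^-1` A2)).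
  by [].
suff -> : lam (B `&` polar_coord @^-1` (A1 `*` A2)) = m1 A1.
  suff -> : m1 A1 = m2 A1.
    by rewrite m2E muleC.
  have := (@measure_unique _ R (measurableTypeR R) (@RGenInftyO.G R)
    (fun k => `]-oo, k%:R[%classic) _ _ _ _ m1 m2).
  apply => //.
  - exact: RGenInftyO.measurableE.
  - move=> _ _ [x ->] [y ->]; exists (Num.min x y).
    by apply/seteqP; split=> z; rewrite /= !in_itv/= lt_min => /andP.
  - by move=> k; exists k%:R.
  - apply/seteqP; split => // x _; exists (Num.trunc `|x|).+1 => //=.
    rewrite in_itv/= (le_lt_trans (ler_norm _))//.
    exact: truncnS_gt.
  - move=> _ [s ->]; rewrite m1E m2E.
    (* For s <= 0 both sides vanish: norms are nonnegative and the radial weight is zero on negative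
       reals. *)
    have [s0|s0] := leP s 0%R.
      rewrite [X in lam X](_ : _ = set0); last first.
        apply/seteqP; split => x //= -[]; rewrite in_itv/= => xs.
        by have := lt_le_trans xs s0; rewrite ltNge enorm_ge0.
      rewrite measure0; apply/esym/eqP; rewrite mule_eq0; apply/orP; right.
      apply/eqP.
      rewrite /radial_measure radial_weightE -integral_mkcondr.
      rewrite (_ : _ `&` _ = set0) ?integral_set0//.
      apply/seteqP; split => x //=; rewrite !in_itv/= => -[xs /andP[x0 _]].
      by have := lt_le_trans xs s0; rewrite ltNge x0.
    (* Intersecting with the ball truncates the radius at min(s, 1), and the factor d in [surface]
       cancels the 1/d of the radial integral. *)
    rewrite radial_measure_itv// surfaceE.
    have ms : (0 < Num.min s 1)%R by rewrite lt_min s0 ltr01.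
    rewrite (_ : _ `&` _ =
      [set x | (enorm x < Num.min s 1)%R] `&` @direction R d @^-1` A2).
      rewrite lebesgue_rV_cone// muleAC -EFinM mulrCA mulfV ?mulr1//.
    apply/seteqP; split => x; rewrite /uball/= in_itv/= lt_min.
      by move=> [-> [-> ?]].
    by move=> [/andP[-> ->]].
  - move=> k; rewrite m1E.
    apply: le_lt_trans (lebesgue_rV_uball_lty R d).
    apply: le_measure; rewrite ?inE; last by move=> x [_ []].
      apply: measurableI => //.
      by rewrite -[X in measurable X]setTI; exact: measurable_enorm.
    exact: measurable_uball.
rewrite m1E; congr (lam _).
by apply/seteqP; split => x /= [] //= => [? []|? []].
Qed.

End polar.

(** * Integration in polar coordinates *)

Section polar_integral.
Variables (R : realType) (n : nat).
Local Notation d := n.+1.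
Local Notation leb := (@lebesgue_measure R).
Local Notation I01 := (`[0%R, 1%R]%classic : set (measurableTypeR R)).
Local Notation B := (uball R d).
Local Notation dB := (usphere R d).
Local Notation lam := (lebesgue_rV R d).
Local Notation sigma := (surface R d).
Local Notation nu := (@radial_measure R n).
Local Notation polar := (@polar_coord R n).
Local Open Scope ereal_scope.

(** The image [m] of Lebesgue measure on the ball under polar coordinates agrees with the product
    measure on rectangles, hence equals it; the rest is the change of variables for an image
    measure. *)
Lemma ge0_integral_polar (H : measurableTypeR R * 'rV[R]_d -> \bar R) :
  measurable_fun setT H -> (forall z, 0 <= H z) ->
  \int[lam]_(x in B) H (polar x) = \int[nu \x sigma]_z H z.
Proof.
move=> mH H0.
pose M : {measure set 'rV[R]_d -> \bar R} := mrestr lam (measurable_uball R d).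
pose m : {measure set (measurableTypeR R * 'rV[R]_d) -> \bar R} :=
  measure_function_pushforward__canonical__measure_function_Measure
  M (@measurable_polar_coord R n).
have mE X : m X = lam (B `&` polar @^-1` X) by rewrite setIC.
transitivity (\int[m]_z H z); last first.
  apply: eq_measure_integral => X mX _; apply/esym.
  apply: product_measure_unique => // A1 A2 mA1 mA2.
  by rewrite mE lebesgue_rV_polar.
have := @ge0_integral_pushforward _ _ _ _ R polar (@measurable_polar_coord R n) M
  setT H measurableT mH (fun z _ => H0 z).
rewrite -[integral (pushforward _ _) _ _]/(\int[m]_z H z) => ->.
rewrite preimage_setT.
rewrite (@ge0_integral_density _ _ _ lam M (\1_B))//.
- rewrite [LHS]integral_mkcond; apply: eq_integral => x _.
  by rewrite patchE indicE/=; case: (x \in B); rewrite ?mule1 ?mule0.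
- by apply: measurable_indic; exact: measurable_uball.
- move=> A mA; rewrite integral_indic//; last exact: measurable_uball.
  by rewrite setIC.
- by apply: measurableT_comp => //; exact: measurable_polar_coord.
- by move=> x /=; exact: H0.
Qed.

Lemma integral_polar (h : measurableTypeR R * 'rV[R]_d -> R) :
  measurable_fun setT h ->
  \int[lam]_(x in B) (h (polar x))%:E = \int[nu \x sigma]_z (h z)%:E.
Proof.
move=> mh; have mhE : measurable_fun setT (EFin \o h) by exact/measurable_EFinP.
rewrite integralE [RHS]integralE -!ge0_integral_polar//.
- by congr (_ - _); apply: eq_integral => x _; rewrite ?funeposE ?funenegE.
- exact: measurable_funeneg.
- exact: measurable_funepos.
Qed.

(** Tonelli applied to absolute values gives integrability on the product, and Fubini then splits
    the integral. *)
Lemma integral_polar_factor (u : measurableTypeR R -> R) (v : 'rV[R]_d -> R) :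
  measurable_fun setT u -> measurable_fun setT v ->
  leb.-integrable setT (fun r => (u r * radial_weight n r)%:E) ->
  sigma.-integrable setT (EFin \o v) ->
  lam.-integrable B (fun x => (u (enorm x) * v (direction x))%:E) /\
  \int[lam]_(x in B) (u (enorm x) * v (direction x))%:E =
  \int[leb]_r (u r * radial_weight n r)%:E * \int[sigma]_y (v y)%:E.
Proof.
move=> mu mv iu iv.
pose h (z : measurableTypeR R * 'rV[R]_d) := (u z.1 * v z.2)%R.
have mh : measurable_fun setT h.
  apply: measurable_funM.
    exact: (measurableT_comp mu measurable_fst).
  exact: (measurableT_comp mv measurable_snd).
have mw : measurable_fun setT (radial_weight n : measurableTypeR R -> R).
  exact: measurable_radial_weight.
have w0 := @radial_weight_ge0 R n.
have nuE A : measurable A -> nu A = \int[leb]_(x in A) (radial_weight n x)%:E by [].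
have nu_u : nu.-integrable setT (EFin \o u).
  exact: (integrable_density mw w0 nuE mu iu).
have ih : (nu \x sigma).-integrable setT (EFin \o h).
  apply/integrableP; split; first exact/measurable_EFinP.
  rewrite (fubini_tonelli1 (fun z => `|(h z)%:E|)) //=; last first.
    by apply/measurable_EFinP; exact: measurableT_comp.
  rewrite /fubini_F.
  under eq_integral => x _.
    under eq_integral do rewrite /h/= normrM EFinM.
    rewrite ge0_integralZl//; last first.
      by apply/measurable_EFinP; exact: measurableT_comp.
    over.
  move/integrableP : iv => [_ iv]; move/integrableP : nu_u => [_ nu_u].
  rewrite ge0_integralZr//; last 2 first.
  - by apply/measurable_EFinP; exact: measurableT_comp.
  - exact: integral_ge0.
  rewrite lte_mul_pinfty// ?ge0_fin_numE//; exact: integral_ge0.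
split.
  apply/integrableP; split.
    apply/measurable_EFinP/measurable_funTS.
    exact: (measurableT_comp mh (@measurable_polar_coord R n)).
  move/integrableP : ih => [_]; rewrite -ge0_integral_polar//.
  by apply: measurableT_comp => //; exact/measurable_EFinP.
rewrite (integral_polar mh) -(integral12_prod_meas1 ih) /fubini_F/=.
under eq_integral => x _.
  under eq_integral do rewrite /h/= EFinM.
  rewrite integralZl//.
  over.
rewrite -(integral_density mw w0 nuE mu).
have := integrable_fin_num measurableT iv.
case: (integral _ _ _) => // c _.
by rewrite integralZr.
Qed.

End polar_integral.

(** * Complex-valued square-integrable functions *)

Section complex_parts.
Local Open Scope complex_scope.
Variable R : rcfType.
Implicit Types x y : R[i].

Lemma ReD x y : complex.Re (x + y) = complex.Re x + complex.Re y.
Proof. by case: x y => [a b] [c e]. Qed.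

Lemma ImD x y : complex.Im (x + y) = complex.Im x + complex.Im y.
Proof. by case: x y => [a b] [c e]. Qed.

Lemma ReM x y : complex.Re (x * y) =
  complex.Re x * complex.Re y - complex.Im x * complex.Im y.
Proof. by case: x y => [a b] [c e]. Qed.

Lemma ImM x y : complex.Im (x * y) =
  complex.Re x * complex.Im y + complex.Im x * complex.Re y.
Proof. by case: x y => [a b] [c e]. Qed.

Lemma ReJ x : complex.Re x^*%C = complex.Re x.
Proof. by case: x. Qed.

Lemma ImJ x : complex.Im x^*%C = - complex.Im x.
Proof. by case: x. Qed.

Lemma conjcD x y : (x + y)^*%C = x^*%C + y^*%C.
Proof. exact: rmorphD. Qed.

Lemma conjcB x y : (x - y)^*%C = x^*%C - y^*%C.
Proof. exact: rmorphB. Qed.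

Lemma conjcM x y : (x * y)^*%C = x^*%C * y^*%C.
Proof. exact: rmorphM. Qed.

Lemma normc_ge0 x : 0 <= normc x.
Proof. by case: x => a b; exact: sqrtr_ge0. Qed.

Lemma sqr_normc_Re_Im x : normc x ^+ 2 = complex.Re x ^+ 2 + complex.Im x ^+ 2.
Proof. by case: x => a b; rewrite sqr_sqrtr// addr_ge0// sqr_ge0. Qed.

Lemma mulcJ x : x * x^*%C = (normc x ^+ 2)%:C.
Proof.
rewrite sqr_normc_Re_Im; case: x => a b; apply/eqP; rewrite eq_complex/=.
by rewrite mulrN opprK !expr2 eqxx mulrN mulrC addNr eqxx.
Qed.

Lemma normc_real (r : R) : normc (r%:C) = `|r|.
Proof. by rewrite /= expr0n addr0 sqrtr_sqr. Qed.

Lemma normc_conjc x : normc x^*%C = normc x.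
Proof. by case: x => a b /=; rewrite sqrrN. Qed.

Lemma Re_le_normc x : `|complex.Re x| <= normc x.
Proof.
case: x => a b /=; rewrite -sqrtr_sqr ler_wsqrtr// lerDl; exact: sqr_ge0.
Qed.

Lemma Im_le_normc x : `|complex.Im x| <= normc x.
Proof.
case: x => a b /=; rewrite -sqrtr_sqr ler_wsqrtr// lerDr; exact: sqr_ge0.
Qed.

Lemma normc_le_Re_Im x : normc x <= `|complex.Re x| + `|complex.Im x|.
Proof.
rewrite -ler_sqr ?nnegrE ?normc_ge0 ?addr_ge0// sqr_normc_Re_Im sqrrD.
by rewrite !real_normK ?num_real// lerD2r lerDl mulrn_wge0// mulr_ge0.
Qed.

End complex_parts.

Section cintegral_theory.
Local Open Scope complex_scope.
Context disp (T : measurableType disp) (R : realType).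
Variables (mu : {measure set T -> \bar R}) (D : set T).
Hypothesis mD : measurable D.
Implicit Types f g h : T -> R[i].

Definition cintegrable f :=
  mu.-integrable D (EFin \o (fun x => complex.Re (f x))) /\
  mu.-integrable D (EFin \o (fun x => complex.Im (f x))).

Lemma eq_cintegral f g : {in D, f =1 g} -> cintegral mu D f = cintegral mu D g.
Proof.
by move=> fg; congr Complex; apply: eq_Rintegral => x xD; rewrite fg.
Qed.

Lemma cintegrableD f g : cintegrable f -> cintegrable g ->
  cintegrable (fun x => f x + g x).
Proof.
move=> [f1 f2] [g1 g2]; split.
- under [X in _.-integrable _ X]eq_fun do rewrite /= ReD EFinD.
  exact: (integrableD mD f1 g1).
- under [X in _.-integrable _ X]eq_fun do rewrite /= ImD EFinD.
  exact: (integrableD mD f2 g2).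
Qed.

Lemma cintegralD f g : cintegrable f -> cintegrable g ->
  cintegral mu D (fun x => f x + g x) = cintegral mu D f + cintegral mu D g.
Proof.
move=> [f1 f2] [g1 g2]; apply/eqP; rewrite eq_complex ReD ImD/=.
under eq_Rintegral do rewrite ReD.
under [X in _ && (X == _)]eq_Rintegral do rewrite ImD.
by rewrite !RintegralD// !eqxx.
Qed.

Lemma integrableZ (a : R) (u : T -> R) : mu.-integrable D (EFin \o u) ->
  mu.-integrable D (EFin \o (fun x => a * u x)).
Proof.
by move=> iu; under [X in _.-integrable _ X]eq_fun do rewrite /= EFinM;
  exact: (integrableZl mD a iu).
Qed.

Lemma cintegrableZ (c : R[i]) f : cintegrable f -> cintegrable (fun x => c * f x).
Proof.
move=> [f1 f2]; split.
- under [X in _.-integrable _ X]eq_fun do rewrite /= ReM EFinB.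
  by apply: (integrableB mD (integrableZ _ f1) (integrableZ _ f2)).
- under [X in _.-integrable _ X]eq_fun do rewrite /= ImM EFinD.
  by apply: (integrableD mD (integrableZ _ f2) (integrableZ _ f1)).
Qed.

Lemma cintegralZ (c : R[i]) f : cintegrable f ->
  cintegral mu D (fun x => c * f x) = c * cintegral mu D f.
Proof.
move=> [f1 f2]; apply/eqP; rewrite eq_complex ReM ImM/=.
under eq_Rintegral do rewrite ReM.
under [X in _ && (X == _)]eq_Rintegral do rewrite ImM.
rewrite RintegralB//; [|exact: integrableZ..].
rewrite RintegralD//; [|exact: integrableZ..].
by rewrite !RintegralZl// !eqxx.
Qed.

Lemma cintegralJ f : cintegrable f ->
  cintegral mu D (fun x => (f x)^*%C) = (cintegral mu D f)^*%C.
Proof.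
move=> [f1 f2]; apply/eqP; rewrite eq_complex ReJ ImJ/=.
under eq_Rintegral do rewrite ReJ.
under [X in _ && (X == _)]eq_Rintegral do rewrite ImJ -mulN1r.
by rewrite RintegralZl// mulN1r !eqxx.
Qed.

Lemma cintegrableB f g : cintegrable f -> cintegrable g ->
  cintegrable (fun x => f x - g x).
Proof.
move=> if_ ig; have := cintegrableD if_ (cintegrableZ (-1) ig).
by under eq_fun do rewrite mulN1r.
Qed.

Lemma cintegralB f g : cintegrable f -> cintegrable g ->
  cintegral mu D (fun x => f x - g x) = cintegral mu D f - cintegral mu D g.
Proof.
move=> if_ ig; rewrite -mulN1r -cintegralZ// -cintegralD//; last exact: cintegrableZ.
by apply: eq_cintegral => x _; rewrite mulN1r.
Qed.

Lemma cmeasurableD f g : cmeasurable D f -> cmeasurable D g ->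
  cmeasurable D (fun x => f x + g x).
Proof.
move=> [f1 f2] [g1 g2]; split.
- by under eq_fun do rewrite ReD; exact: measurable_funD.
- by under eq_fun do rewrite ImD; exact: measurable_funD.
Qed.

Lemma cmeasurableM f g : cmeasurable D f -> cmeasurable D g ->
  cmeasurable D (fun x => f x * g x).
Proof.
move=> [f1 f2] [g1 g2]; split.
- under eq_fun do rewrite ReM; apply: measurable_funB; exact: measurable_funM.
- under eq_fun do rewrite ImM; apply: measurable_funD; exact: measurable_funM.
Qed.

Lemma cmeasurableJ f : cmeasurable D f -> cmeasurable D (fun x => (f x)^*%C).
Proof.
move=> [f1 f2]; split; first by under eq_fun do rewrite ReJ.
under eq_fun do rewrite ImJ; exact: measurableT_comp.
Qed.

Lemma cmeasurable_cst (c : R[i]) : cmeasurable D (fun=> c).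
Proof. by split; exact: measurable_cst. Qed.

Lemma measurable_sqr_normc f : cmeasurable D f ->
  measurable_fun D (fun x => normc (f x) ^+ 2).
Proof.
move=> [f1 f2]; under eq_fun do rewrite sqr_normc_Re_Im.
by apply: measurable_funD; exact: measurable_funX.
Qed.

Lemma measurable_normc f : cmeasurable D f ->
  measurable_fun D (fun x => normc (f x)).
Proof.
move=> mf; have mf2 := measurable_sqr_normc mf.
rewrite (_ : (fun x => _) = (fun x => (normc (f x) ^+ 2) `^ 2^-1)); last first.
  by apply/funext => x; rewrite powR12_sqrt ?sqr_ge0// sqrtr_sqr ger0_norm// normc_ge0.
exact: (measurableT_comp (measurable_powR _) mf2).
Qed.

Lemma le_cintegrable f (u : T -> R) : cmeasurable D f ->
  mu.-integrable D (EFin \o u) -> (forall x, D x -> normc (f x) <= u x) ->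
  cintegrable f.
Proof.
move=> [f1 f2] iu fu; split.
- apply: (le_integrable mD _ _ iu); first exact/measurable_EFinP.
  move=> x Dx; rewrite /= lee_fin (le_trans (Re_le_normc _))//.
  by rewrite (le_trans (fu _ Dx))// ler_norm.
- apply: (le_integrable mD _ _ iu); first exact/measurable_EFinP.
  move=> x Dx; rewrite /= lee_fin (le_trans (Im_le_normc _))//.
  by rewrite (le_trans (fu _ Dx))// ler_norm.
Qed.

(** The factor 2 is the price of bounding real and imaginary parts separately. It does no harm where
    the bound is applied, to errors that tend to 0. *)
Lemma normc_cintegral_le f (u : T -> R) : cintegrable f ->
  mu.-integrable D (EFin \o u) -> (forall x, D x -> normc (f x) <= u x) ->
  normc (cintegral mu D f) <= 2 * Rintegral mu D u.
Proof.
move=> [f1 f2] iu fu; apply: (le_trans (normc_le_Re_Im _)).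
rewrite mulr_natl mulr2n; apply: lerD => /=.
- apply: (le_trans (le_normr_Rintegral mD f1)).
  apply: le_Rintegral => //; first exact: integrable_norm.
  by move=> x Dx; rewrite (le_trans (Re_le_normc _))// fu.
- apply: (le_trans (le_normr_Rintegral mD f2)).
  apply: le_Rintegral => //; first exact: integrable_norm.
  by move=> x Dx; rewrite (le_trans (Im_le_normc _))// fu.
Qed.

End cintegral_theory.

(** * Inner products, squared norms and the Cauchy-Schwarz inequality *)

Section L2_theory.
Local Open Scope complex_scope.
Context disp (T : measurableType disp) (R : realType).
Variables (mu : {measure set T -> \bar R}) (D : set T).
Hypothesis mD : measurable D.
Implicit Types f g h : T -> R[i].

Definition sqnorm f : R := Rintegral mu D (fun x => normc (f x) ^+ 2).

Lemma sqnorm_ge0 f : 0 <= sqnorm f.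
Proof. by apply: Rintegral_ge0 => x _; exact: sqr_ge0. Qed.

Lemma cnorm2E f : cnorm mu D 2%:E f =
  ((\int[mu]_(x in D) (normc (f x) ^+ 2)%:E) `^ 2^-1)%E.
Proof.
rewrite /cnorm unlock; congr poweR; rewrite [RHS]integral_mkcond.
apply: eq_integral => x _; rewrite !patchE; case: ifPn => _.
  by rewrite gee0_abs ?lee_fin ?normc_ge0// poweR_EFin powR_mulrn ?normc_ge0.
by rewrite abse0 poweR0r.
Qed.

Lemma L2P f : L2 mu D f <-> cmeasurable D f /\
  mu.-integrable D (EFin \o (fun x => normc (f x) ^+ 2)).
Proof.
rewrite /L2 cnorm2E; split => -[mf fin]; split => //.
  apply/integrableP; split.
    by apply/measurable_EFinP; exact: measurable_sqr_normc.
  under eq_integral do rewrite /= ger0_norm ?sqr_ge0//.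
  by apply: lty_poweRy fin; rewrite invr_neq0.
move/integrableP : fin => [_].
under eq_integral do rewrite /= ger0_norm ?sqr_ge0//.
exact: poweR_lty.
Qed.

Lemma cnorm2_sqnorm f : L2 mu D f -> cnorm mu D 2%:E f = (Num.sqrt (sqnorm f))%:E.
Proof.
move=> /L2P[mf fin]; rewrite cnorm2E.
have /fineK <- := integrable_fin_num mD fin.
by rewrite poweR_EFin powR12_sqrt// fine_ge0// integral_ge0// => x _; rewrite lee_fin sqr_ge0.
Qed.

Lemma normcD_sqr_le (a b : R[i]) : normc (a + b) ^+ 2 <= 2 * normc a ^+ 2 + 2 * normc b ^+ 2.
Proof.
apply: (@le_trans _ _ ((normc a + normc b) ^+ 2)).
  by rewrite ler_sqr ?nnegrE ?addr_ge0 ?normc_ge0// le_normcD.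
by have := sqr_ge0 (normc a - normc b); nra.
Qed.

Lemma L2D f g : L2 mu D f -> L2 mu D g -> L2 mu D (fun x => f x + g x).
Proof.
move=> /L2P[mf if_] /L2P[mg ig]; have mfg := cmeasurableD mf mg.
apply/L2P; split => //.
apply: (le_integrable mD _ _
  (integrableD mD (integrableZ mD 2 if_) (integrableZ mD 2 ig))).
  by apply/measurable_EFinP; exact: measurable_sqr_normc.
move=> x Dx /=; rewrite lee_fin !ger0_norm ?sqr_ge0 ?addr_ge0 ?mulr_ge0 ?normc_ge0//.
exact: normcD_sqr_le.
Qed.

Lemma L2Z (c : R[i]) f : L2 mu D f -> L2 mu D (fun x => c * f x).
Proof.
move=> /L2P[mf if_]; apply/L2P; split.
  by apply: cmeasurableM => //; exact: cmeasurable_cst.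
under [X in _.-integrable _ X]eq_fun do rewrite /= normcM exprMn.
exact: (integrableZ mD _ if_).
Qed.

Lemma L20 : L2 mu D (fun=> 0).
Proof.
apply/L2P; split; first exact: cmeasurable_cst.
rewrite (_ : EFin \o _ = cst 0%E); first exact: integrable0.
by apply/funext => x; rewrite /comp normc0 expr0n.
Qed.

Lemma L2B f g : L2 mu D f -> L2 mu D g -> L2 mu D (fun x => f x - g x).
Proof.
move=> f2 g2; have := L2D f2 (L2Z (-1) g2).
by under eq_fun do rewrite mulN1r.
Qed.

Lemma L2_cintegrable f g : L2 mu D f -> L2 mu D g ->
  cintegrable mu D (fun x => f x * (g x)^*%C).
Proof.
move=> /L2P[mf if_] /L2P[mg ig].
apply: (@le_cintegrable _ _ _ _ _ mD _ (fun x => normc (f x) ^+ 2 + normc (g x) ^+ 2)).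
- by apply: cmeasurableM => //; exact: cmeasurableJ.
- exact: (integrableD mD if_ ig).
- move=> x _; rewrite normcM normc_conjc.
  have := sqr_ge0 (normc (f x) - normc (g x)).
  have := sqr_ge0 (normc (f x) + normc (g x)); nra.
Qed.

Lemma innerDl f g h : L2 mu D f -> L2 mu D g -> L2 mu D h ->
  inner mu D (fun x => f x + g x) h = inner mu D f h + inner mu D g h.
Proof.
move=> f2 g2 h2; rewrite /inner -cintegralD//; [|exact: L2_cintegrable..].
by apply: eq_cintegral => x _; rewrite mulrDl.
Qed.

Lemma innerZl (c : R[i]) f g : L2 mu D f -> L2 mu D g ->
  inner mu D (fun x => c * f x) g = c * inner mu D f g.
Proof.
move=> f2 g2; rewrite /inner -cintegralZ//; last exact: L2_cintegrable.
by apply: eq_cintegral => x _; rewrite mulrA.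
Qed.

Lemma inner_conj f g : L2 mu D f -> L2 mu D g ->
  (inner mu D f g)^*%C = inner mu D g f.
Proof.
move=> f2 g2; rewrite /inner -cintegralJ//; last exact: L2_cintegrable.
by apply: eq_cintegral => x _; rewrite conjcM conjcK mulrC.
Qed.

Lemma innerDr f g h : L2 mu D f -> L2 mu D g -> L2 mu D h ->
  inner mu D h (fun x => f x + g x) = inner mu D h f + inner mu D h g.
Proof.
move=> f2 g2 h2; rewrite -inner_conj//; last exact: L2D.
by rewrite innerDl// conjcD !inner_conj.
Qed.

Lemma innerZr (c : R[i]) f g : L2 mu D f -> L2 mu D g ->
  inner mu D g (fun x => c * f x) = c^*%C * inner mu D g f.
Proof.
move=> f2 g2; rewrite -inner_conj//; last exact: L2Z.
by rewrite innerZl// conjcM inner_conj.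
Qed.

Lemma innerBl f g h : L2 mu D f -> L2 mu D g -> L2 mu D h ->
  inner mu D (fun x => f x - g x) h = inner mu D f h - inner mu D g h.
Proof.
move=> f2 g2 h2; rewrite -[X in _ - X]mul1r -mulNr -innerZl// -innerDl//.
  by congr inner; apply/funext => x; rewrite mulN1r.
exact: L2Z.
Qed.

Lemma innerBr f g h : L2 mu D f -> L2 mu D g -> L2 mu D h ->
  inner mu D h (fun x => f x - g x) = inner mu D h f - inner mu D h g.
Proof.
move=> f2 g2 h2; rewrite -inner_conj//; last exact: L2B.
by rewrite innerBl// conjcB !inner_conj.
Qed.

Lemma inner0l g : inner mu D (fun=> 0) g = 0.
Proof.
rewrite /inner /cintegral; under eq_Rintegral do rewrite mul0r.
under [X in Complex _ X]eq_Rintegral do rewrite mul0r.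
by rewrite /Rintegral integral0.
Qed.

Lemma inner_sqnorm f : inner mu D f f = (sqnorm f)%:C.
Proof.
rewrite /inner /cintegral; congr Complex.
  by apply: eq_Rintegral => x _; rewrite mulcJ.
rewrite (@eq_Rintegral _ _ _ _ _ (fun=> 0)); first by rewrite /Rintegral integral0.
by move=> x _; rewrite mulcJ.
Qed.

Lemma cauchy_schwarz f g : L2 mu D f -> L2 mu D g ->
  normc (inner mu D f g) ^+ 2 <= sqnorm f * sqnorm g.
Proof.
move=> f2 g2; set z := inner mu D f g; set Z := normc z ^+ 2.
have ZE : Z%:C = z * z^*%C by rewrite mulcJ.
have Z_ge0 : 0 <= Z by exact: sqr_ge0.
(* [Z] becomes a single atom for [ring], tied to [z] only through [ZE]. *)
clearbody Z.
(* This is the squared norm of f - t z g, expanded for real t. *)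
have key (t : R) : 0 <= sqnorm f - 2 * t * Z + t ^+ 2 * Z * sqnorm g.
  have g2' := L2Z (t%:C * z) g2.
  have : 0 <= (sqnorm (fun x => f x - (t%:C * z) * g x))%:C.
    by rewrite ler0c sqnorm_ge0.
  rewrite -inner_sqnorm innerBl//; last exact: L2B.
  rewrite !innerBr// !innerZl// !innerZr// !inner_sqnorm -(inner_conj f2 g2) -/z.
  rewrite conjcM conjc_real.
  rewrite (_ : _ - _ = (sqnorm f - 2 * t * Z + t ^+ 2 * Z * sqnorm g)%:C) ?ler0c//.
  transitivity ((sqnorm f)%:C - 2 * t%:C * Z%:C + t%:C ^+ 2 * Z%:C * (sqnorm g)%:C).
    by rewrite ZE; ring.
  by ring.
have [g0|g0] := eqVneq (sqnorm g) 0; last first.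
  have gp : 0 < sqnorm g by rewrite lt0r g0 sqnorm_ge0.
  have := key (sqnorm g)^-1.
  rewrite -(pmulr_lge0 _ gp).
  suff -> : (sqnorm f - 2 * (sqnorm g)^-1 * Z + (sqnorm g)^-1 ^+ 2 * Z * sqnorm g) * sqnorm g
    = sqnorm f * sqnorm g - Z by rewrite subr_ge0.
  by field.
(* If g has norm 0, [key] is affine in t; the t chosen next would make it equal to -1 if Z were
   positive. *)
rewrite g0 mulr0 leNgt; apply/negP => Z0.
have := key ((sqnorm f + 1) / (2 * Z)); rewrite g0 mulr0 addr0.
rewrite (_ : _ - _ = -1) ?ler0N1//.
by field; rewrite gt_eqF.
Qed.

End L2_theory.

(** * Bessel's inequality and closed spans *)

Section orthonormal_families.
Local Open Scope complex_scope.
Context disp (T : measurableType disp) (R : realType).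
Variables (mu : {measure set T -> \bar R}) (D : set T).
Hypothesis mD : measurable D.
Variables (I : eqType) (e : I -> T -> R[i]).
Hypothesis e2 : forall i, L2 mu D (e i).
Implicit Types (h t : T -> R[i]) (c : I -> R[i]) (s : seq I).

Let comb s c : T -> R[i] := fun x => \sum_(i <- s) c i * e i x.

Let comb_cons i s c : comb (i :: s) c = fun x => c i * e i x + comb s c x.
Proof. by apply/funext => x; rewrite /comb big_cons. Qed.

Let comb_nil c : comb [::] c = fun=> 0.
Proof. by apply/funext => x; rewrite /comb big_nil. Qed.

Lemma L2_comb s c : L2 mu D (fun x => \sum_(i <- s) c i * e i x).
Proof.
rewrite -/(comb s c); elim: s => [|i s IH]; first by rewrite comb_nil; exact: L20.
by rewrite comb_cons; apply: L2D => //; exact: L2Z.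
Qed.

Lemma inner_combl s c h : L2 mu D h ->
  inner mu D (fun x => \sum_(i <- s) c i * e i x) h = \sum_(i <- s) c i * inner mu D (e i) h.
Proof.
move=> h2; rewrite -/(comb s c); elim: s => [|i s IH].
  by rewrite comb_nil inner0l big_nil.
rewrite comb_cons big_cons innerDl//; [|exact: L2Z|exact: L2_comb].
by rewrite innerZl// IH.
Qed.

Lemma inner_combr s c h : L2 mu D h ->
  inner mu D h (fun x => \sum_(i <- s) c i * e i x) =
  \sum_(i <- s) (c i)^*%C * inner mu D h (e i).
Proof.
move=> h2; rewrite -/(comb s c); elim: s => [|i s IH].
  by rewrite comb_nil -inner_conj//; [rewrite inner0l big_nil conjc0|exact: L20].
rewrite comb_cons big_cons innerDr//; [|exact: L2Z|exact: L2_comb].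
by rewrite innerZr// IH.
Qed.

(** [closed_span] allows lists with repeated indices, whereas the Pythagorean identity below needs
    distinct ones; repetitions are absorbed into the coefficients. *)
Lemma comb_undup s c (x : T) : \sum_(i <- s) c i * e i x =
  \sum_(i <- undup s) (c i *+ count_mem i s) * e i x.
Proof.
rewrite -big_undup_iterop_count; apply: eq_bigr => i _.
by rewrite mulrnAl.
Qed.

Hypothesis e_orth : forall i j, inner mu D (e i) (e j) = (i == j)%:R.

(** Completing the square: the last sum is the cost of using coefficients other than the Fourier
    coefficients. Bessel takes c to be the latter; for closed spans the sum is dropped as
    nonnegative. *)
Lemma sqnorm_sub_comb s c h : uniq s -> L2 mu D h ->
  sqnorm mu D (fun x => h x - \sum_(i <- s) c i * e i x) =
  sqnorm mu D h - \sum_(i <- s) normc (inner mu D h (e i)) ^+ 2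
    + \sum_(i <- s) normc (inner mu D h (e i) - c i) ^+ 2.
Proof.
move=> us h2; apply: complexI; rewrite -inner_sqnorm.
have p2 := L2_comb s c; have hp2 := L2B mD h2 p2.
have pp : inner mu D (fun x => \sum_(i <- s) c i * e i x)
    (fun x => \sum_(i <- s) c i * e i x) = \sum_(i <- s) c i * (c i)^*%C.
  rewrite inner_combl//; apply: eq_big_seq => i si; congr (_ * _).
  rewrite inner_combr// (bigD1_seq i)//= e_orth eqxx mulr1 big1 ?addr0//.
  by move=> j /negPf ji; rewrite e_orth eq_sym ji mulr0.
rewrite innerBl// !innerBr// inner_sqnorm pp inner_combl// inner_combr//.
have sumC F : (\sum_(i <- s) F i)%:C = \sum_(i <- s) (F i)%:C :> R[i].
  exact: rmorph_sum.
have addC (x y : R) : (x + y)%:C = x%:C + y%:C by exact: rmorphD.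
have oppC (x : R) : (- x)%:C = - x%:C by exact: rmorphN.
rewrite -!addrA !addC oppC !sumC; congr (_ + _).
rewrite opprB -!sumrN -!big_split.
apply: eq_bigr => i _; rewrite -!mulcJ -(inner_conj mD h2 (e2 i)) conjcB.
set a := inner mu D h (e i).
by move=> /=; ring.
Qed.

Lemma bessel s h : uniq s -> L2 mu D h ->
  \sum_(i <- s) normc (inner mu D h (e i)) ^+ 2 <= sqnorm mu D h.
Proof.
move=> us h2; rewrite -subr_ge0.
have := sqnorm_ge0 mu D (fun x => h x - \sum_(i <- s) inner mu D h (e i) * e i x).
rewrite sqnorm_sub_comb// [X in _ + X]big1 ?addr0// => i _.
by rewrite subrr normc0 expr0n.
Qed.

(** The nontrivial half of Parseval, kept finite at the cost of [eps]. The approximation is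
    requested within [Num.sqrt eps] since squared norms are compared. *)
Lemma closed_span_sqnorm h (eps : R) : closed_span mu D e h -> 0 < eps ->
  exists2 s, uniq s &
    sqnorm mu D h <= eps + \sum_(i <- s) normc (inner mu D h (e i)) ^+ 2.
Proof.
move=> [h2 hs] eps0; have /hs[s [c]] : 0 < Num.sqrt eps by rewrite sqrtr_gt0.
rewrite cnorm2_sqnorm//; last exact: L2B h2 (L2_comb s c).
rewrite lte_fin ltr_sqrt// => lt_eps.
exists (undup s); first exact: undup_uniq.
move: lt_eps; under [X in sqnorm _ _ X]eq_fun do rewrite comb_undup.
rewrite sqnorm_sub_comb ?undup_uniq// => /ltW.
rewrite -lerBlDr; apply: le_trans.
by rewrite lerDl sumr_ge0// => i _; exact: sqr_ge0.
Qed.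

(** Subtracting a finite combination p does not change the inner product with t, and Cauchy-Schwarz
    makes that of h - p small. *)
Lemma closed_span_orthogonal h t : closed_span mu D e h -> L2 mu D t ->
  (forall i, inner mu D (e i) t = 0) -> inner mu D h t = 0.
Proof.
move=> [h2 hs] t2 et; apply: eq0_normc; apply/eqP.
rewrite -sqrf_eq0 eq_le sqr_ge0 andbT; apply/ler_addgt0Pl => eps eps0.
rewrite addr0.
have tp : 0 < sqnorm mu D t + 1 by rewrite ltr_wpDl ?sqnorm_ge0.
(* The accuracy for which the Cauchy-Schwarz bound is at most [eps]; adding 1 covers a t of norm
   0. *)
have /hs[s [c]] : 0 < Num.sqrt (eps / (sqnorm mu D t + 1)).
  by rewrite sqrtr_gt0 divr_gt0.
have p2 := L2_comb s c; have hp2 := L2B mD h2 p2.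
rewrite cnorm2_sqnorm// lte_fin ltr_sqrt ?divr_gt0// => /ltW lt_eps.
have -> : inner mu D h t = inner mu D (fun x => h x - \sum_(i <- s) c i * e i x) t.
  by rewrite innerBl// inner_combl// big1 ?subr0// => i _; rewrite et mulr0.
apply: (le_trans (cauchy_schwarz mD hp2 t2)).
apply: (@le_trans _ _ (eps / (sqnorm mu D t + 1) * (sqnorm mu D t + 1))).
  by apply: ler_pM => //; [exact: sqnorm_ge0|exact: sqnorm_ge0|rewrite lerDl].
by rewrite divfK// gt_eqF.
Qed.

End orthonormal_families.

(** * Products of a radial and a spherical function *)

Section spherical_coordinates.
Local Open Scope complex_scope.
Variables (R : realType) (n : nat).
Local Notation d := n.+1.
Local Notation leb := (@lebesgue_measure R).
Local Notation I01 := (`[0%R, 1%R]%classic : set (measurableTypeR R)).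
Local Notation B := (uball R d).
Local Notation dB := (usphere R d).
Local Notation lam := (lebesgue_rV R d).
Local Notation sigma := (surface R d).

(** At the origin [direction] leaves the sphere, so functions in polar form are controlled only
    elsewhere; one point does not affect measurability. *)
Lemma measurable_fun_uball (h h' : 'rV[R]_d -> R) : measurable_fun setT h' ->
  {in B `\ 0, h =1 h'} -> measurable_fun B h.
Proof.
move=> mh' hh'; have m0 := @measurable_rV0 R d.
have mB0 : measurable (B `\ 0) by apply: measurableD => //; exact: measurable_uball.
have mh : measurable_fun (B `\ 0) h.
  apply: (eq_measurable_fun h'); last exact: measurable_funTS.
  by move=> x xB; rewrite hh'.
have B0 : B 0 by rewrite /uball/= enorm0.
rewrite -(setD1K B0); apply/measurable_funU => //; split => //.
exact: measurable_fun_set1.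
Qed.

Lemma measurable_spherical (u : measurableTypeR R -> R) (v : 'rV[R]_d -> R) :
  measurable_fun I01 u -> measurable_fun dB v ->
  measurable_fun B (fun x => u (enorm x) * v (direction x)).
Proof.
move=> mu mv; pose u' := u \_ I01; pose v' := v \_ dB.
have mu' : measurable_fun setT u'.
  by apply/(measurable_restrictT u) => //; exact: measurable_itv.
have mv' : measurable_fun setT v'.
  by apply/(measurable_restrictT v) => //; exact: measurable_usphere.
apply: (@measurable_fun_uball _ (fun x => u' (enorm x) * v' (direction x))).
  apply: measurable_funM; first exact: (measurableT_comp mu' (@measurable_enorm R d)).
  exact: (measurableT_comp mv' (measurable_direction R d)).
move=> x; rewrite inE => -[Bx /= /eqP x0]; rewrite /u' /v' !patchE !mem_set//.
  exact: direction_usphere.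
by rewrite /= in_itv/= enorm_ge0 ltW.
Qed.

(** u and v are known only on [0, 1] and on the sphere. Their extensions by zero satisfy the global
    polar formula, and the product changes at most at the origin, a null set. *)
Lemma Rintegral_spherical (u : measurableTypeR R -> R) (v : 'rV[R]_d -> R) :
  measurable_fun I01 u -> measurable_fun dB v ->
  leb.-integrable I01 (EFin \o (fun r => u r * r ^+ n)) ->
  sigma.-integrable dB (EFin \o v) ->
  let h x := u (enorm x) * v (direction x) in
  lam.-integrable B (EFin \o h) /\
  Rintegral lam B h = Rintegral leb I01 (fun r => u r * r ^+ n) * Rintegral sigma dB v.
Proof.
move=> mu mv iu iv h.
have mdB := @measurable_usphere R d.
have mB := measurable_uball R d.
have m0 := @measurable_rV0 R d.
have mI : measurable I01 by exact: measurable_itv.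
pose u' := u \_ I01; pose v' := v \_ dB.
have mu' : measurable_fun setT u' by exact/(measurable_restrictT u mI).
have mv' : measurable_fun setT v' by exact/(measurable_restrictT v mdB).
have uE : (fun r => (u' r * radial_weight n r)%:E) =
    (EFin \o (fun r => u r * r ^+ n)) \_ I01.
  apply/funext => r; rewrite /u' /radial_weight !patchE indicE.
  by case: (r \in I01); rewrite /= ?mulr1 ?mulr0.
have vE : EFin \o v' = (EFin \o v) \_ dB.
  by apply/funext => y; rewrite /v' /= !patchE; case: (y \in dB).
have iu' : leb.-integrable setT (fun r => (u' r * radial_weight n r)%:E).
  by rewrite uE -integrable_mkcond.
have iv' : sigma.-integrable setT (EFin \o v').
  by rewrite vE -integrable_mkcond.
pose h' x := u' (enorm x) * v' (direction x).
have [ih' Ih'] := integral_polar_factor mu' mv' iu' iv'.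
have hh' : {in B `\ 0, h =1 h'}.
  move=> x; rewrite inE => -[Bx /= /eqP x0]; rewrite /h /h' /u' /v' !patchE !mem_set//.
    exact: direction_usphere.
  by rewrite /= in_itv/= enorm_ge0 ltW.
have mh : measurable_fun B h := measurable_spherical mu mv.
have lam0 : lam [set 0] = 0 by exact: lebesgue_rV_set0.
have ih'0 : lam.-integrable (B `\ 0) (EFin \o h').
  by apply/(negligible_integrable m0 mB) => //; exact: (measurable_int lam ih').
have ih : lam.-integrable B (EFin \o h).
  apply/(negligible_integrable m0 mB) => //; first exact/measurable_EFinP.
  by apply: eq_integrable ih'0; [exact: measurableD|move=> x xB; rewrite /= hh'].
split => //; rewrite /Rintegral (negligible_integral m0 mB ih)//.
rewrite (eq_integral (EFin \o h')); last by move=> x xB; rewrite /= hh'.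
rewrite -(negligible_integral m0 mB ih')// Ih' fineM; last 2 first.
- exact: integrable_fin_num iu'.
- exact: integrable_fin_num iv'.
by congr (fine _ * fine _); [rewrite [RHS]integral_mkcond uE|rewrite [RHS]integral_mkcond -vE].
Qed.

Lemma cintegral_spherical (u : R -> R[i]) (v : 'rV[R]_d -> R[i]) :
  cmeasurable I01 u -> cmeasurable dB v ->
  cintegrable leb I01 (fun r => u r * (r ^+ n)%:C) ->
  cintegrable sigma dB v ->
  let h x := u (enorm x) * v (direction x) in
  cintegrable lam B h /\
  cintegral lam B h =
    cintegral leb I01 (fun r => u r * (r ^+ n)%:C) * cintegral sigma dB v.
Proof.
move=> [mu1 mu2] [mv1 mv2] [iu1 iu2] [iv1 iv2] h.
have ReE r : complex.Re (u r * (r ^+ n)%:C) = complex.Re (u r) * r ^+ n.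
  by rewrite ReM /= mulr0 subr0.
have ImE r : complex.Im (u r * (r ^+ n)%:C) = complex.Im (u r) * r ^+ n.
  by rewrite ImM /= mulr0 add0r.
have iu1' : leb.-integrable I01 (EFin \o (fun r => complex.Re (u r) * r ^+ n)).
  by apply: eq_integrable iu1 => // r _; rewrite /comp ReE.
have iu2' : leb.-integrable I01 (EFin \o (fun r => complex.Im (u r) * r ^+ n)).
  by apply: eq_integrable iu2 => // r _; rewrite /comp ImE.
have [i11 I11] := Rintegral_spherical mu1 mv1 iu1' iv1.
have [i12 I12] := Rintegral_spherical mu1 mv2 iu1' iv2.
have [i21 I21] := Rintegral_spherical mu2 mv1 iu2' iv1.
have [i22 I22] := Rintegral_spherical mu2 mv2 iu2' iv2.
have mB := measurable_uball R d.
split.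
  split.
    apply: eq_integrable (integrableB mB i11 i22) => // x _.
    by rewrite /comp /h ReM EFinB.
  apply: eq_integrable (integrableD mB i12 i21) => // x _.
  by rewrite /comp /h ImM EFinD.
have -> : cintegral leb I01 (fun r => u r * (r ^+ n)%:C) =
    Complex (Rintegral leb I01 (fun r => complex.Re (u r) * r ^+ n))
      (Rintegral leb I01 (fun r => complex.Im (u r) * r ^+ n)).
  by congr Complex; apply: eq_Rintegral => r _; rewrite ?ReE ?ImE.
apply/eqP; rewrite eq_complex ReM ImM/=; apply/andP; split; apply/eqP.
  by under eq_Rintegral do rewrite ReM; rewrite RintegralB//= I11 I22.
by under eq_Rintegral do rewrite ImM; rewrite RintegralD//= I12 I21.
Qed.

End spherical_coordinates.

Section spherical_L2.
Local Open Scope complex_scope.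
Variables (R : realType) (n : nat).
Local Notation d := n.+1.
Local Notation leb := (@lebesgue_measure R).
Local Notation I01 := (`[0%R, 1%R]%classic : set (measurableTypeR R)).
Local Notation B := (uball R d).
Local Notation dB := (usphere R d).
Local Notation lam := (lebesgue_rV R d).
Local Notation sigma := (surface R d).
Implicit Types (u : R -> R[i]) (v : 'rV[R]_d -> R[i]).

Lemma cmeasurable_spherical u v : cmeasurable I01 u -> cmeasurable dB v ->
  cmeasurable B (fun x => u (enorm x) * v (direction x)).
Proof.
move=> [mu1 mu2] [mv1 mv2]; split.
- under eq_fun do rewrite ReM.
  by apply: measurable_funB; [exact: (measurable_spherical mu1 mv1)
    |exact: (measurable_spherical mu2 mv2)].
- under eq_fun do rewrite ImM.
  by apply: measurable_funD; [exact: (measurable_spherical mu1 mv2)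
    |exact: (measurable_spherical mu2 mv1)].
Qed.

Lemma radial_L2_integrable u : radial_L2 d u ->
  leb.-integrable I01 (EFin \o (fun r => normc (u r) ^+ 2 * r ^+ n)).
Proof.
move=> [mu iu]; apply/integrableP; split.
  apply/measurable_EFinP; apply: measurable_funM.
    exact: measurable_sqr_normc.
  exact: measurable_funX.
apply: le_lt_trans iu; rewrite le_eqVlt; apply/orP; left; apply/eqP.
apply: eq_integral => r; rewrite inE/= in_itv/= => /andP[r0 _].
by rewrite ger0_norm// mulr_ge0// ?sqr_ge0// exprn_ge0.
Qed.

Lemma L2_spherical u v : radial_L2 d u -> L2 sigma dB v ->
  L2 lam B (fun x => u (enorm x) * v (direction x)).
Proof.
move=> u2 /L2P[mv iv]; have [mu _] := u2; apply/L2P; split.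
  exact: cmeasurable_spherical.
have [] := Rintegral_spherical (measurable_sqr_normc mu) (measurable_sqr_normc mv)
  (radial_L2_integrable u2) iv.
move=> iuv _; apply: eq_integrable iuv; first exact: measurable_uball.
by move=> x _; rewrite /comp normcM exprMn.
Qed.

Lemma cintegrable_radial u1 u2 : radial_L2 d u1 -> radial_L2 d u2 ->
  cintegrable leb I01 (fun r => u1 r * (u2 r)^*%C * (r ^+ n)%:C).
Proof.
move=> u12 u22; have [mu1 _] := u12; have [mu2 _] := u22.
have mI : measurable I01 by exact: measurable_itv.
apply: (@le_cintegrable _ _ _ _ _ mI _
  (fun r => normc (u1 r) ^+ 2 * r ^+ n + normc (u2 r) ^+ 2 * r ^+ n)).
- apply: cmeasurableM; first by apply: cmeasurableM => //; exact: cmeasurableJ.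
  split; first exact: measurable_funX.
  exact: measurable_cst.
- exact: (integrableD mI (radial_L2_integrable u12) (radial_L2_integrable u22)).
- move=> r; rewrite /= in_itv/= => /andP[r0 _].
  have rn : 0 <= r ^+ n by rewrite exprn_ge0.
  rewrite !normcM normc_real normc_conjc ger0_norm// -mulrDl ler_wpM2r//.
  have := sqr_ge0 (normc (u1 r) - normc (u2 r)).
  have := sqr_ge0 (normc (u1 r) + normc (u2 r)); nra.
Qed.

Lemma inner_spherical u1 u2 v1 v2 :
  radial_L2 d u1 -> radial_L2 d u2 -> L2 sigma dB v1 -> L2 sigma dB v2 ->
  inner lam B (fun x => u1 (enorm x) * v1 (direction x))
              (fun x => u2 (enorm x) * v2 (direction x)) =
  radial_inner d u1 u2 * inner sigma dB v1 v2.
Proof.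
move=> u12 u22 v12 v22; have [mu1 _] := u12; have [mu2 _] := u22.
have [mv1 _] := v12; have [mv2 _] := v22.
have mdB := @measurable_usphere R d.
have [||] := @cintegral_spherical _ _ (fun r => u1 r * (u2 r)^*%C)
  (fun y => v1 y * (v2 y)^*%C) _ _ (cintegrable_radial u12 u22)
  (L2_cintegrable mdB v12 v22).
- by apply: cmeasurableM => //; exact: cmeasurableJ.
- by apply: cmeasurableM => //; exact: cmeasurableJ.
move=> _ <-; apply: eq_cintegral => x _.
by rewrite conjcM mulrACA.
Qed.

End spherical_L2.

(** * Continuous functions on the closed ball *)

Section continuous_rV.
Variables (R : realType) (d : nat).
Implicit Types (D : set 'rV[R]_d) (F : 'rV[R]_d -> R).

Lemma within_continuous_rVP D F : {within D, continuous F} ->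
  forall x (e : R), D x -> 0 < e -> exists2 rho : R, 0 < rho &
    forall y, D y -> (forall i, `|x 0 i - y 0 i| < rho) -> `|F x - F y| < e.
Proof.
move=> /subspace_continuousP cF x e Dx e0.
have /cvgrPdist_lt/(_ _ e0)/nbhs_ballP[rho /= rho0 xrho] := cF x Dx.
exists rho => // y Dy xy; apply: xrho => //; split => // i j.
by rewrite (ord1 i); exact: xy.
Qed.

(** The sigma-algebra is generated by coordinates, so the preimage of an open interval is written as
    D intersected with a countable union of boxes with rational centre and radius 1/(m+1). *)
Lemma measurable_within_continuous_rV D F : measurable D ->
  {within D, continuous F} -> measurable_fun D F.
Proof.
move=> mD cF; have {}cF := within_continuous_rVP cF.
apply: (measurability _ (RGenOpens.measurableE R)) => _ [_ [a [b ->]] <-].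
pose box (p : 'rV[rat]_d * nat) : set 'rV[R]_d :=
  [set x | forall i, `|x 0 i - ratr (p.1 0 i)| < p.2.+1%:R^-1].
have mbox p : measurable (box p).
  rewrite (_ : box p = \bigcap_(i in [set: 'I_d])
      (fun x : 'rV[R]_d => x 0 i) @^-1` ball (ratr (p.1 0 i) : R) p.2.+1%:R^-1).
    apply: fin_bigcap_measurable => // i _.
    rewrite -[X in measurable X]setTI; apply: (measurable_coord i) => //.
    exact: measurable_ball.
  apply/seteqP; split => x /= xp i => [_|]; first by rewrite /ball/= distrC.
  by have := xp i Logic.I; rewrite /ball/= distrC.
pose good := [set p | D `&` box p `<=` F @^-1` `]a, b[].
rewrite (_ : _ `&` _ = D `&` \bigcup_p (if p \in good then box p else set0)).
  apply: measurableI => //; apply: countable_bigcupT_measurable => // p.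
  by case: ifPn.
apply/seteqP; split => [x [Dx Fx]|x [Dx [p _]]]; last first.
  by case: ifPn => [/set_mem gp xp|_ []]; split => //; exact: gp.
split => //; move: Fx; rewrite /= in_itv/= => /andP[aF Fb].
have [|rho rho0 xrho] := cF x (Num.min (F x - a) (b - F x)) Dx.
  by rewrite lt_min !subr_gt0 aF.
(* With 1/(m+1) below rho/2, all coordinates of two points of the same box differ by less than
   rho. *)
have [m _ /(_ m (leqnn m)) /= mrho] :=
  near_infty_natSinv_lt (PosNum (divr_gt0 rho0 (ltr0n R 2))).
have /choice[q qE] (i : 'I_d) : exists q : rat, `|x 0 i - ratr q| < m.+1%:R^-1.
  have : x 0 i - m.+1%:R^-1 < x 0 i + m.+1%:R^-1.
    by rewrite ltrBlDr -addrA ltrDl addr_gt0// invr_gt0.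
  move=> /rat_in_itvoo[q]; rewrite in_itv/= => /andP[q1 q2]; exists q.
  by rewrite distrC ltr_distl q1.
pose p : 'rV[rat]_d * nat := (\row_i q i, m).
exists p => //; rewrite ifT.
  by move=> i; rewrite /p/= mxE.
apply/mem_set => y [Dy yp]; have : `|F x - F y| < Num.min (F x - a) (b - F x).
  apply: xrho => // i; have := yp i; rewrite /p/= mxE => yqi.
  rewrite -(subrKA (ratr (q i))) (le_lt_trans (ler_normD _ _))//.
  rewrite [ltRHS]splitr ltrD// ?(lt_trans (qE i))//.
  by rewrite distrC (lt_trans yqi).
rewrite lt_min => /andP[]; rewrite !ltr_norml => /andP[? ?] /andP[? ?].
by rewrite /= in_itv/=; apply/andP; split; lra.
Qed.

Lemma usphere_compact : compact (usphere R d).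
Proof.
apply: bounded_closed_compact.
  exists 1; split => // M M1 x x1; rewrite /= (le_trans _ (ltW M1))//.
  rewrite /Num.Def.normr/= mx_normrE (bigmax_le _ ler01)//= => -[i j] _ /=.
  by rewrite (ord1 i) -x1 coord_le_enorm.
rewrite (_ : usphere R d = (fun x => \sum_i x 0 i ^+ 2) @^-1` [set 1]); last first.
  apply/seteqP; split => x /=; rewrite -sqr_enorm.
    by move=> ->; rewrite expr1n.
  move=> /eqP; rewrite sqrp_eq1 ?enorm_ge0// => /eqP //.
have c : continuous (fun x : 'rV[R]_d => \sum_i x 0 i ^+ 2).
  apply: continuous_big; first exact: add_continuous.
  move=> i _ x; apply: (@continuous_comp 'rV[R]_d R R (fun x => x 0 i) (fun t => t ^+ 2)).
    exact: coord_continuous.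
  exact: exprn_continuous.
by apply: closed_comp => [x _|]; [exact: c|exact: closed_eq].
Qed.

Lemma within_continuous_bounded F : {within usphere R d, continuous F} ->
  exists M, forall x, usphere R d x -> `|F x| <= M.
Proof.
move=> cF; have /compact_bounded[M [_ FM]] := continuous_compact cF usphere_compact.
exists (M + 1) => x x1; apply: (FM (M + 1)); first by rewrite ltrDl.
by exists x.
Qed.

(** Continuity at each point of the sphere gives a local shell thickness; compactness of the sphere
    makes one thickness work for all directions. *)
Lemma radially_uniform F (e : R) : {within cuball R d, continuous F} -> 0 < e ->
  exists2 delta : R, 0 < delta < 1 &
    forall x, uball R d x -> 1 - delta <= enorm x -> `|F x - F (direction x)| < e.
Proof.
move=> cF e0; have := usphere_compact.
move=> /compact_near_coveringP/near_covering_withinP /(_ _ (0%R^'+)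
  (fun delta y => forall r, 0 <= r <= 1 -> 1 - delta <= r -> `|F (r *: y) - F y| < e)).
move=> [y Sy|delta0 /= delta00 H].
  have [||rho rho0 yrho] := within_continuous_rVP cF (x := y) (e := e / 2).
  - by rewrite /cuball/= Sy.
  - by rewrite divr_gt0.
  (* Half of rho goes to moving y to y', half to moving y' to r y', as each coordinate of y' changes
     by at most 1 - r. So F at y' and at r y' is within e/2 of F at y. *)
  exists (ball y (rho / 2), [set delta | delta < rho / 2]); first split => /=.
  - by apply: nbhsx_ballx; rewrite divr_gt0.
  - by apply: nbhs_right_lt; rewrite divr_gt0.
  move=> [y' delta] /= [[_ yy'] dr] Sy' r /andP[r0 r1] dr1.
  rewrite distrC -(subrKA (F y)) (le_lt_trans (ler_normD _ _))// [ltRHS]splitr.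
  have cS : cuball R d y' by rewrite /cuball/= Sy'.
  have cr : cuball R d (r *: y').
    by rewrite /cuball/= enormZ Sy' mulr1 ger0_norm.
  apply: ltrD.
    rewrite distrC yrho// => i; rewrite (lt_le_trans (yy' _ _))//.
    by rewrite ler_pdivrMr// ler_peMr ?ltW// ltr1n.
  rewrite yrho// => i; rewrite mxE -(subrKA (y' 0 i)).
  rewrite (le_lt_trans (ler_normD _ _))// [ltRHS]splitr ltr_leD//.
    exact: yy'.
  rewrite -[X in X - _]mul1r -mulrBl normrM ger0_norm ?subr_ge0//.
  have := coord_le_enorm y' i; rewrite Sy' => y'1.
  by rewrite (le_trans (ler_piMr _ y'1)) ?subr_ge0//; lra.
(* Below [delta0] for [H] to apply, and below 1 so that the shell avoids the origin. *)
pose t := Num.min delta0 1 / 2.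
have t0 : 0 < t by rewrite divr_gt0// lt_min delta00 ltr01.
have tm : t < Num.min delta0 1.
  by rewrite ltr_pdivrMr// ltr_pMr ?ltr1n// lt_min delta00 ltr01.
have [td t1] : t < delta0 /\ t < 1 by move: tm; rewrite lt_min => /andP.
exists t; first by rewrite t0.
move=> x x1 xt; have x0 : x != 0.
  by rewrite -enorm_gt0 (lt_le_trans _ xt)// subr_gt0.
rewrite [in F x](scale_direction x).
apply: (H t) => //.
- by rewrite /ball/= sub0r normrN gtr0_norm.
- exact: direction_usphere.
- by rewrite enorm_ge0 ltW.
Qed.

End continuous_rV.

(** * Boundary coefficients *)

Section boundary_coefficient.
Local Open Scope complex_scope.
Variables (R : realType) (n : nat).
Local Notation d := n.+1.
Local Notation leb := (@lebesgue_measure R).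
Local Notation I01 := (`[0%R, 1%R]%classic : set (measurableTypeR R)).
Local Notation B := (uball R d).
Local Notation dB := (usphere R d).
Local Notation lam := (lebesgue_rV R d).
Local Notation sigma := (surface R d).

Definition shell_indic (t r : R) : R := \1_(`[1 - t, +oo[%classic) r.

Lemma shell_indicE t r : shell_indic t r = (1 - t <= r)%R%:R.
Proof. by rewrite /shell_indic indicE mem_setE in_itv/= andbT. Qed.

Lemma measurable_shell_indic t : measurable_fun setT (shell_indic t).
Proof. exact: measurable_indic. Qed.

Definition shell_mass (t : R) := Rintegral leb I01 (fun r => shell_indic t r * r ^+ n).

Lemma integrable_shell_indic t :
  leb.-integrable I01 (EFin \o (fun r => shell_indic t r * r ^+ n)).
Proof.
apply: measurable_bounded_integrable => //.
- by rewrite [ltLHS]lebesgue_measure_itv/= lte_fin ltr01 -EFinD ltry.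
- apply: measurable_funM; last exact: measurable_funX.
  by apply: measurable_funTS; exact: measurable_shell_indic.
- exists 1; split => // M M1 r /=; rewrite in_itv/= => /andP[r0 r1].
  rewrite (le_trans _ (ltW M1))// shell_indicE normrM normr_nat.
  by case: (_ <= r); rewrite ?mul0r// mul1r ger0_norm ?exprn_ge0 ?exprn_ile1.
Qed.

(** On [1 - t, 1] the weight r^n is at least (1 - t)^n, so the mass is at least (1 - t)^n t. *)
Lemma shell_mass_gt0 t : 0 < t < 1 -> 0 < shell_mass t.
Proof.
move=> /andP[t0 t1].
have it : leb.-integrable I01 (EFin \o (fun r => (1 - t) ^+ n * shell_indic t r)).
  apply: integrableZ => //; apply: measurable_bounded_integrable => //.
  - by rewrite [ltLHS]lebesgue_measure_itv/= lte_fin ltr01 -EFinD ltry.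
  - by apply: measurable_funTS; exact: measurable_shell_indic.
  - exists 1; split => // M M1 r /= _.
    by rewrite (le_trans _ (ltW M1))// shell_indicE; case: (_ <= r); rewrite ?normr1 ?normr0.
apply: (@lt_le_trans _ _ (Rintegral leb I01 (fun r => (1 - t) ^+ n * shell_indic t r))).
  rewrite RintegralZl//; last first.
    have := integrableZ (mu := leb) (measurable_itv `[0%R, 1%R]) ((1 - t) ^+ n)^-1 it.
    apply: eq_integrable => // r _; rewrite /comp mulrA mulVf ?mul1r//.
    by rewrite expf_neq0// gt_eqF// subr_gt0.
  rewrite mulr_gt0 ?exprn_gt0 ?subr_gt0//.
  rewrite /Rintegral integral_indic//=.
  rewrite (_ : _ `&` _ = `[(1 - t), 1%R]%classic); last first.
    apply/seteqP; split => r; rewrite /= !in_itv/= ?andbT.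
      by move=> [? /andP[]] *; apply/andP.
    by move=> /andP[tr r1]; split => //; rewrite r1 andbT (le_trans _ tr)// subr_ge0 ltW.
  rewrite lebesgue_measure_itv/= lte_fin ltrBlDr ltrDl t0 -EFinD/=.
  by rewrite opprB addrCA subrr addr0.
apply: le_Rintegral => //; first exact: integrable_shell_indic.
move=> r _; rewrite shell_indicE; have [tr|tr] := leP (1 - t) r; last by rewrite mulr0 mul0r.
by rewrite mulr1 mul1r; apply: lerXn2r => //; rewrite nnegrE; lra.
Qed.

Let chi t : R -> R[i] := fun r => (shell_indic t r)%:C.

Let chi1 t r : 1 - t <= r -> chi t r = 1.
Proof. by rewrite /chi shell_indicE => ->. Qed.

Let chi0 t r : r < 1 - t -> chi t r = 0.
Proof. by rewrite /chi shell_indicE ltNge => /negPf ->. Qed.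

Let chi_radial_L2 t : radial_L2 d (chi t).
Proof.
split; first split.
- by apply: measurable_funTS; exact: measurable_shell_indic.
- exact: measurable_cst.
- have /integrableP[_] := integrable_shell_indic t; apply: le_lt_trans.
  apply: ge0_le_integral => //.
  + move=> r /=; rewrite in_itv/= => /andP[r0 _].
    by rewrite lee_fin mulr_ge0 ?sqr_ge0 ?exprn_ge0.
  + apply/measurable_EFinP; apply: measurable_funM; last exact: measurable_funX.
    apply: measurable_sqr_normc; split; last exact: measurable_cst.
    by apply: measurable_funTS; exact: measurable_shell_indic.
  + apply/measurable_EFinP; apply: measurableT_comp => //.
    apply: measurable_funM; last exact: measurable_funX.
    by apply: measurable_funTS; exact: measurable_shell_indic.
  + move=> r r01; have /andP[r0 _] : 0 <= r <= 1 by move: r01; rewrite /= in_itv.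
    rewrite /chi normc_real /comp lee_fin.
    rewrite shell_indicE; case: (_ <= r); last first.
      by rewrite normr0 expr0n !mul0r normr0.
    rewrite normr1 expr1n.
    by rewrite mul1r ler_norm.
Qed.

Let radial_chi_chi t : radial_inner d (chi t) (chi t) = (shell_mass t)%:C.
Proof.
have E r : chi t r * (chi t r)^*%C * (r ^+ d.-1)%:C = (shell_indic t r * r ^+ n)%:C.
  have ss : shell_indic t r * shell_indic t r = shell_indic t r.
    by rewrite shell_indicE; case: (_ <= r); rewrite ?mulr1 ?mulr0.
  apply/eqP; rewrite eq_complex/= !(oppr0, mulr0, mul0r, subr0, addr0, add0r) ss.
  by rewrite !eqxx.
rewrite /radial_inner /cintegral; congr Complex.
  by apply: eq_Rintegral => r _; rewrite E.
rewrite (@eq_Rintegral _ _ _ _ _ (fun=> 0)); first by rewrite /Rintegral integral0.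
by move=> r _; rewrite E.
Qed.

Variables (N : eqType) (f : N -> 'rV[R]_d -> R[i]) (g : N -> R -> R[i]).
Hypothesis f_on : orthonormal_family sigma dB f.
Hypothesis g_L2 : forall i, radial_L2 d (g i).
Hypothesis g_unit : forall i, radial_inner d (g i) (g i) = 1.

Let psi i (x : 'rV[R]_d) := g i (enorm x) * f i (direction x).

(** Orthogonality for distinct indices comes from the angular factors alone; radial factors of
    distinct indices need not be orthogonal to each other, only of norm one. *)
Lemma spherical_orthonormal : orthonormal_family lam B
  (fun i (x : 'rV[R]_d) => g i (enorm x) * f i (direction x)).
Proof.
have [f2 fo] := f_on; split=> [i|i j]; first exact: L2_spherical.
rewrite inner_spherical// fo; case: eqVneq => [->|_]; last by rewrite mulr0.
by rewrite g_unit mulr1.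
Qed.

Lemma inner_shell_indic i t h : closed_span lam B psi h ->
  inner lam B h (fun x => chi t (enorm x) * f i (direction x)) =
  radial_inner d (g i) (chi t) * inner lam B h (psi i).
Proof.
move=> hs; have [h2 _] := hs; have [f2 fo] := f_on.
have mB := @measurable_uball R d.
have [p2 po] := spherical_orthonormal.
set G := radial_inner _ _ _; set T := fun x => _.
have T2 : L2 lam B T by exact: L2_spherical.
have Gp2 := L2Z mB (G^*%C) (p2 i).
(* [T - G^* psi_i] is orthogonal to every [psi_j], hence to [h]. *)
have := closed_span_orthogonal mB p2 hs (L2B mB T2 Gp2).
rewrite innerBr// innerZr// ?conjcK.
move=> H; apply/eqP; rewrite -subr_eq0; apply/eqP/H => j.
rewrite innerBr// innerZr// conjcK po inner_spherical// fo.
by case: eqVneq => [->|_]; rewrite ?mulr1 ?mulr0 ?subrr.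
Qed.

Variable F : 'rV[R]_d -> R.
Hypothesis F_cont : {within cuball R d, continuous F}.
Let FC (x : 'rV[R]_d) := (F x)%:C.

Lemma L2_usphere : L2 sigma dB FC.
Proof.
have F_cont' : {within dB, continuous F}.
  by apply: continuous_subspaceW F_cont => x; rewrite /cuball/usphere/= => ->.
have mdB := @measurable_usphere R d.
have mF := measurable_within_continuous_rV mdB F_cont'.
have [M FM] := within_continuous_bounded F_cont'.
apply/L2P; split; first by split => //; exact: measurable_cst.
apply: measurable_bounded_integrable => //.
- by rewrite -ge0_fin_numE// fin_num_measure.
- by apply: measurable_sqr_normc; split => //; exact: measurable_cst.
exists (M ^+ 2); split; first exact: num_real.
move=> M' MM' x xdB; apply: (le_trans _ (ltW MM')); rewrite /FC normc_real.
have := FM x xdB; rewrite normrX normr_id => FxM.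
by rewrite ler_sqr ?nnegrE// (le_trans _ FxM).
Qed.

Lemma boundary_coefficient i : closed_span lam B psi FC ->
  (forall e : R, 0 < e -> exists2 rho : R, 0 < rho &
    forall r, 0 <= r <= 1 -> 1 - rho <= r -> normc (g i r - g i 1) <= e) ->
  inner sigma dB FC (f i) = g i 1 * inner lam B FC (psi i).
Proof.
move=> hs g_cont; have [h2 _] := hs; have [f2 fo] := f_on.
have mB := @measurable_uball R d.
have mdB := @measurable_usphere R d.
have mI : measurable I01 by exact: measurable_itv.
set b := inner sigma _ _ _; set c := inner lam _ _ _.
(* The sphere has finite measure and |f_i| <= 1 + |f_i|^2. *)
have if1 : sigma.-integrable dB (EFin \o (fun y => normc (f i y))).
  have i1 : sigma.-integrable dB (cst 1%E).
    apply/integrableP; split => //; rewrite integral_cst//= normr1 mul1e.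
    by rewrite -ge0_fin_numE// fin_num_measure.
  have [mfi ifi] := (L2P sigma dB (f i)).1 (f2 i).
  apply: (le_integrable mdB _ _ (integrableD mdB i1 ifi)).
    by apply/measurable_EFinP; exact: measurable_normc.
  move=> x _; rewrite /= lee_fin ger0_norm ?normc_ge0//.
  rewrite ger0_norm ?addr_ge0 ?sqr_ge0//.
  by have := sqr_ge0 (normc (f i x) - 1); have := normc_ge0 (f i x); nra.
pose A := Rintegral sigma dB (fun y => normc (f i y)).
have A0 : 0 <= A by apply: Rintegral_ge0 => x _; exact: normc_ge0.
(* The bracket does not depend on [e], so letting [e] tend to 0 forces equality. *)
suff key e : 0 < e -> normc (b - g i 1 * c) <= e * (2 * (A + normc c)).
  apply/eqP; rewrite -subr_eq0; apply/eqP/eq0_normc/eqP.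
  rewrite eq_le normc_ge0 andbT; apply/ler_addgt0Pl => e e0; rewrite addr0.
  have K0 : 0 < 2 * (A + normc c) + 1 by rewrite ltr_wpDl// mulr_ge0// addr_ge0// normc_ge0.
  apply: (le_trans (key (e / (2 * (A + normc c) + 1)) _)); first by rewrite divr_gt0.
  by rewrite mulrAC ler_pdivrMr// ler_pM2l// lerDl.
move=> e0; have [rho rho0 g_rho] := g_cont e e0.
have [delta /andP[delta0 delta1] F_delta] := radially_uniform F_cont e0.
(* Test against [f i] on the shell [1 - t <= |x| < 1]: dividing by the mass of
   the shell, [h |-> <h, T> / m] tends to the boundary coefficient. *)
pose t := Num.min rho delta.
have t0 : 0 < t by rewrite lt_min rho0.
have t1 : t < 1 by rewrite gt_min delta1 orbT.
pose G := radial_inner d (g i) (chi t).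
pose T x := chi t (enorm x) * f i (direction x).
pose m := shell_mass t.
have m0 : 0 < m by apply: shell_mass_gt0; rewrite t0.
have E1 : inner lam B FC T = G * c by exact: inner_shell_indic.
have T2 : L2 lam B T by exact: L2_spherical.
have FC2 := L2_usphere.
(* The boundary values of F extended constantly along rays: the inner product of [FT] with [T]
   factors exactly into the mass times [b]. *)
pose FT x := chi t (enorm x) * FC (direction x).
have FT2 : L2 lam B FT by exact: L2_spherical.
have E2 : inner lam B FT T = m%:C * b by rewrite inner_spherical// radial_chi_chi.
(* The cost of replacing F on the shell by its boundary values. *)
have D1 : normc (inner lam B FC T - m%:C * b) <= 2 * (e * (m * A)).
  rewrite -E2 -innerBl//.
  have [iu Iu] := Rintegral_spherical
    (measurable_funTS (measurable_shell_indic t))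
    (measurable_normc (f2 i).1) (integrable_shell_indic t) if1.
  rewrite -/m -/A in Iu; rewrite -Iu -RintegralZl//.
  apply: normc_cintegral_le => //.
  - by apply: L2_cintegrable => //; exact: L2B.
  - exact: integrableZ.
  move=> x Bx; rewrite normcM normc_conjc /T /FT shell_indicE.
  have [tx|tx] := leP (1 - t) (enorm x).
    rewrite chi1// !mul1r -[FC x - _](rmorphB (real_complex R)) normc_real.
    rewrite ler_wpM2r ?normc_ge0// ltW// F_delta//.
    by apply: le_trans tx; rewrite lerD2l lerN2 ge_min lexx orbT.
  by rewrite chi0// !mul0r normc0 mulr0 mulr0.
(* The cost of replacing g_i on the shell by its value at 1. *)
have D2 : normc (G - g i 1 * m%:C) <= 2 * (e * m).
  rewrite -radial_chi_chi -cintegralZ//; last exact: cintegrable_radial.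
  rewrite -cintegralB//; [|exact: cintegrable_radial|]; last first.
    by apply: cintegrableZ => //; exact: cintegrable_radial.
  rewrite /m /shell_mass -RintegralZl//; last exact: integrable_shell_indic.
  apply: normc_cintegral_le => //.
  - apply: cintegrableB => //; first exact: cintegrable_radial.
    by apply: cintegrableZ => //; exact: cintegrable_radial.
  - by apply: integrableZ => //; exact: integrable_shell_indic.
  move=> r r01; have /andP[r0 r1] : 0 <= r <= 1 by move: r01; rewrite /= in_itv.
  have rn : 0 <= r ^+ n by rewrite exprn_ge0.
  rewrite shell_indicE; have [tr|tr] := leP (1 - t) r; last first.
    by rewrite chi0// conjc0 !(mulr0, mul0r) subrr normc0.
  rewrite chi1// conjc1 !mulr1 !mul1r -mulrBl normcM normc_real ger0_norm//.
  rewrite ler_wpM2r// g_rho ?r0//.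
  by apply: le_trans tr; rewrite lerD2l lerN2 ge_min lexx.
(* Since <F, T> = G c, the two errors combine to m (b - g_i(1) c); both bounds carry the factor m,
   which cancels. *)
have : m * normc (b - g i 1 * c) <= m * (e * (2 * (A + normc c))).
  have -> : m * normc (b - g i 1 * c) =
      normc ((G - g i 1 * m%:C) * c - (inner lam B FC T - m%:C * b)).
    rewrite E1 (_ : _ - (_ - _) = m%:C * (b - g i 1 * c)); last by ring.
    by rewrite normcM normc_real gtr0_norm.
  apply: (le_trans (le_normcD _ _)); rewrite normcN normcM.
  have := ler_wpM2r (normc_ge0 c) D2; move: D1; lra.
by rewrite ler_pM2l.
Qed.

End boundary_coefficient.

(** * From the ball to the sphere, and from L^2 to L^oo *)

Section boundary_comparison.
Local Open Scope complex_scope.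
Variables (R : realType) (n : nat).
Local Notation d := n.+1.
Local Notation B := (uball R d).
Local Notation dB := (usphere R d).
Local Notation lam := (lebesgue_rV R d).
Local Notation sigma := (surface R d).

Lemma sqnorm_le_boundary (N : eqType)
    (f : N -> 'rV[R]_d -> R[i]) (g : N -> R -> R[i])
    (F : 'rV[R]_d -> R) (m : R) :
  orthonormal_family sigma dB f ->
  (forall i, radial_L2 d (g i)) -> (forall i, radial_inner d (g i) (g i) = 1) ->
  {within cuball R d, continuous F} ->
  closed_span lam B (fun i x => g i (enorm x) * f i (direction x)) (fun x => (F x)%:C) ->
  (forall i (e : R), 0 < e -> exists2 rho : R, 0 < rho &
    forall r, 0 <= r <= 1 -> 1 - rho <= r -> normc (g i r - g i 1) <= e) ->
  0 < m -> (forall i, m <= normc (g i 1)) ->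
  m ^+ 2 * sqnorm lam B (fun x => (F x)%:C) <= sqnorm sigma dB (fun x => (F x)%:C).
Proof.
move=> f_on g2 g1 Fc hs gc m0 mg.
have mB := @measurable_uball R d.
have mdB := @measurable_usphere R d.
have [p2 po] := spherical_orthonormal f_on g2 g1.
have [f2 fo] := f_on.
apply/ler_addgt0Pl => eps eps0.
(* The tolerance eps / m^2 turns into [eps] after multiplication by m^2. *)
have [s us hle] := closed_span_sqnorm mB p2 po hs (divr_gt0 eps0 (exprn_gt0 2 m0)).
apply: (le_trans (ler_wpM2l (exprn_ge0 2 (ltW m0)) hle)).
rewrite mulrDr mulrC divfK ?gt_eqF ?exprn_gt0// lerD2l mulr_sumr.
apply: le_trans (bessel mdB f2 fo us (L2_usphere Fc)).
apply: ler_sum => i _; rewrite (boundary_coefficient f_on g2 g1 Fc hs (gc i)).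
by rewrite normcM exprMn ler_wpM2r ?sqr_ge0// ler_sqr ?nnegrE ?normc_ge0// ltW.
Qed.

Lemma cnorm2_le_cnormy disp (T : measurableType disp)
    (mu : {measure set T -> \bar R}) (D : set T) (h : T -> R[i]) :
  measurable D -> cmeasurable D h ->
  (cnorm mu D 2%:E h <= mu D `^ 2^-1 * cnorm mu D +oo h)%E.
Proof.
move=> mD mh; rewrite cnorm2E.
(* A positive measure of D ensures that [cnorm] at +oo is an essential supremum, and that the bound
   is infinite when this supremum is. *)
have [muD0|muD0] := eqVneq (mu D) 0%E.
  rewrite muD0 poweR0r ?invr_neq0// mul0e null_set_integral//.
    by rewrite poweR0r ?invr_neq0.
  by apply/measurable_EFinP; exact: measurable_sqr_normc.
have muDp : (0 < mu D)%E by rewrite lt0e muD0 measure_ge0.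
set M := cnorm mu D +oo h.
have hM : {ae mu, forall x, D x -> ((normc (h x))%:E <= M)%E}.
  rewrite /M /cnorm unlock ifT; last by rewrite (lt_le_trans muDp)// le_measure ?inE.
  have := ess_sup_ge mu (abse \o ((fun x => (normc (h x))%:E) \_ D)).
  apply: filterS => x + Dx; rewrite /= patchE mem_set// => /(le_trans _)-> //.
  by rewrite gee0_abs// lee_fin normc_ge0.
have M0 : (0 <= M)%E by exact: Lnorm_ge0.
have [Moo|Mfin] := eqVneq M +oo%E.
  by rewrite Moo gt0_muley ?leey// poweR_gt0.
have [m ME] : exists m, M = m%:E.
  by move: M0 Mfin; case: (M) => // m _ _; exists m.
rewrite ME in hM M0 *; rewrite lee_fin in M0.
apply: (@le_trans _ _ (((m ^+ 2)%:E * mu D) `^ 2^-1)%E).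
  apply: gt0_ler_poweR => //; rewrite ?in_itv/= ?andbT ?leey ?mule_ge0 ?lee_fin
    ?sqr_ge0 ?integral_ge0//.
    by move=> x _; rewrite lee_fin sqr_ge0.
  rewrite -integral_cst//=; apply: ae_ge0_le_integral => //.
  - by move=> x _; rewrite lee_fin sqr_ge0.
  - by apply/measurable_EFinP; exact: measurable_sqr_normc.
  - by move=> x _; rewrite lee_fin sqr_ge0.
  - apply: filterS hM => x hx Dx; rewrite lee_fin.
    by have := hx Dx; rewrite lee_fin => ?; rewrite ler_sqr ?nnegrE ?normc_ge0.
rewrite poweRM ?lee_fin ?sqr_ge0// muleC; apply: lee_wpmul2l; first exact: poweR_ge0.
by rewrite poweR_EFin powR12_sqrt ?sqr_ge0// sqrtr_sqr ger0_norm.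
Qed.

End boundary_comparison.

Unset Implicit Arguments.

Theorem corollary1p7 (R : realType) (d : nat) (hd : (2 <= d)%N)
  (C : R) (C_gt0 : 0 < C) (hC : boundary_stability d C)
  (N K : countType)
  (f : N -> 'rV[R]_d -> R[i]) (g : N -> K -> R -> R[i]) (a : N -> K -> R)
  (hf : orthonormal_basis (surface R d) (usphere R d) f)
  (hg : forall n, radial_orthonormal d (g n))
  (g_cont1 : forall n k,
    (g n k : R -> R[i]^o) @ within `[0, 1] (nbhs (1 : R)) --> (g n k 1 : R[i]^o))
  (g1_inf : 0 < inf [set x | exists n k, x = normc (g n k 1)])
  (eta : R) (eta_gt0 : 0 < eta)
  (ha : forall n k,
    (cnorm (lebesgue_rV R d) (shell eta) +oo (psi f g n k) <= (a n k)%:E)%E)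
  (k : K) (gamma1 gamma2 : 'rV[R]_d -> R)
  (h1 : conductivity gamma1) (h2 : conductivity gamma2)
  (hA : A_space f g a k (fun x => (gamma1 x - gamma2 x)%:C%C)) :
  (cnorm (lebesgue_rV R d) (uball R d) 2%:E (fun x => (gamma1 x - gamma2 x)%:C%C)
    <= surface R d (usphere R d) `^ 2^-1
       * (inf [set normc (g n k 1) | n in [set: N]])^-1%:E
       * C%:E * DN_dist gamma1 gamma2)%E.
Proof.
(* Polar coordinates are set up in dimension n+1; [hd] excludes dimension 0. *)
case: d hd hC f hf hg ha gamma1 gamma2 h1 h2 hA => // n _ hC f hf hg ha
  gamma1 gamma2 h1 h2 [hW _].
set m := inf [set normc (g i k 1) | i in [set: N]].
have lbT : has_lbound [set x | exists i k, x = normc (g i k 1)].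
  by exists 0 => _ [i [j ->]]; exact: normc_ge0.
(* The infimum of the empty set is 0, so [g1_inf] forces [N] to be inhabited. *)
have [i0] : exists i : N, True.
  apply: contrapT => noN; move: g1_inf; rewrite (_ : [set x | _] = set0) ?inf0 ?ltxx//.
  by apply/seteqP; split => // x [i _]; case: noN; exists i.
move=> _.
have lbm i : m <= normc (g i k 1).
  apply: ge_inf; last by exists i.
  by exists 0 => _ [j _ <-]; exact: normc_ge0.
(* [m] is an infimum over fewer values than the one in [g1_inf], hence at least as large; [i0] makes
   its set nonempty. *)
have m0 : 0 < m.
  apply: (lt_le_trans g1_inf); apply: lb_le_inf; first by exists (normc (g i0 k 1)); exists i0.
  by move=> _ [j _ <-]; apply: ge_inf => //; exists j, k.
pose F x := gamma1 x - gamma2 x.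
have Fc : {within cuball R n.+1, continuous F}.
  by move=> x; apply: cvgB; [exact: (h1.1 x)|exact: (h2.1 x)].
have gc i (e : R) : 0 < e -> exists2 rho : R, 0 < rho &
    forall r, 0 <= r <= 1 -> 1 - rho <= r -> normc (g i k r - g i k 1) <= e.
  move=> e0; have /cvgrPdist_lt/(_ e%:C%C) := g_cont1 i k.
  rewrite ltcR => /(_ e0) /nbhs_ballP[rho /= rho0 rhoP].
  (* Halving turns the non-strict 1 - rho/2 <= r into the strict distance bound of the ball of
     radius rho. *)
  exists (rho / 2) => [|r r01 rr]; first by rewrite divr_gt0.
  have /andP[r0 r1] := r01.
  have rb : `|1 - r| < rho by rewrite ger0_norm ?subr_ge0//; lra.
  have := rhoP r rb; rewrite in_itv/= => /(_ r01).
  rewrite -[`|_|]/((normc (g i k 1 - g i k r))%:C%C) ltcR => /ltW.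
  by rewrite -normcN opprB.
have g1 i : radial_inner n.+1 (g i k) (g i k) = 1.
  by rewrite (hg i).2 eqxx.
have FC2 := L2_usphere Fc.
have mdB := @measurable_usphere R n.+1.
have main := sqnorm_le_boundary hf.1 (fun i => (hg i).1 k) g1 Fc hW gc m0 lbm.
have bound : (cnorm (lebesgue_rV R n.+1) (uball R n.+1) 2%:E (fun x => (F x)%:C%C) <=
    m^-1%:E * cnorm (surface R n.+1) (usphere R n.+1) 2%:E (fun x => (F x)%:C%C))%E.
  rewrite (cnorm2_sqnorm (@measurable_uball R n.+1) hW.1) (cnorm2_sqnorm mdB FC2).
  rewrite -EFinM lee_fin ler_pdivlMl//.
  by have := ler_wsqrtr main; rewrite sqrtrM ?sqr_ge0// sqrtr_sqr gtr0_norm.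
have hbound := cnorm2_le_cnormy (surface R n.+1) mdB FC2.1.
have hbound2 := le_trans bound (lee_wpmul2l _ hbound).
apply: (le_trans (hbound2 _)); first by rewrite lee_fin invr_ge0 ltW.
rewrite muleCA -!muleA; apply: lee_wpmul2l; first exact: poweR_ge0.
by apply: lee_wpmul2l; [rewrite lee_fin invr_ge0 ltW|exact: hC].
Qed.
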